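(* Assume that $\{B\in\{-1,1\}^{n\times r} : B^\top B=nI_r,\ B^\top v=0\}\neq\emptyset$. Let $f:\mathbb{R}^{n\times r}\to\mathbb{R}$ be continuously differentiable, let $L_f$ be the Lipschitz modulus of $f$ on $\mathcal{B}_v(n,r)$, and let $f^*$ be the optimal value of $$(Q)\quad \min\{f(X) : X\in\mathcal{B}_v(n,r)\cap\Lambda\}.$$ Let $\kappa>0$ be a constant such that $\mathrm{dist}(Z,\mathcal{B}_v(n,r)\cap\Lambda)\le\kappa\,\mathrm{dist}(Z,\Lambda)$ for all $Z\in\mathcal{B}_v(n,r)$. Then for all $X\in\mathcal{B}_v(n,r)$, $$f(X)-f^*+\kappa L_f\,h_{\frac1{\sqrt n}}(X)\ge 0 .$$ Hence there exists a threshold $\overline\rho=\kappa L_f$ such that, for each $\rho\ge\overline\rho$ (with $\rho>0$), the penalty problem $$\min_{X\in\mathcal{B}_v(n,r)}\ f(X)+\rho\, h_{\frac1{\sqrt n}}(X)$$ has the same global optimal solution set as problem $(Q)$.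
   Context: Let $n,r$ be positive integers and $v\in\mathbb{R}^n$. $\mathcal{B}_v(n,r):=\{X\in\mathbb{R}^{n\times r} : X^\top X=I_r,\ X^\top v=0\}$ (a compact set). $\Lambda:=\{X\in\mathbb{R}^{n\times r} : |X_{ij}|\le\frac1{\sqrt n}\ \forall i,j\}$. $\mathrm{dist}(X,\Omega):=\inf_{Z\in\Omega}\|Z-X\|_F$ is the Frobenius distance to a set $\Omega$. $h_{\frac1{\sqrt n}}(X):=\mathrm{dist}_1(X,\Lambda)=\sum_{i,j}\max(0,|X_{ij}|-\tfrac1{\sqrt n})$ is the entrywise $\ell_1$-distance from $X$ to $\Lambda$. The Lipschitz modulus is with respect to $\|\cdot\|_F$. The existence of a constant $\kappa$ as in the claim is a separate result of the paper (valid under the nonemptiness assumption). The penalty parameter $\rho$ is positive in the definition of the penalty problem. *)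

(* Defs.v *)
From HB Require Import structures.
From mathcomp Require Import all_boot all_order all_algebra.
From mathcomp Require Import all_classical all_reals all_analysis.
From mathcomp Require Import ring lra.

Set Implicit Arguments.
Unset Strict Implicit.
Unset Printing Implicit Defensive.

Import Order.TTheory GRing.Theory Num.Theory.
Import numFieldNormedType.Exports.

Local Open Scope classical_set_scope.
Local Open Scope ring_scope.

Section Definitions.
Variable R : realType.

Section Optimization.
Variable T : Type.

Definition optimal_value (F : T -> R) (S : set T) : R := inf (F @` S).

Definition argmin (F : T -> R) (S : set T) : set T :=
  [set X | S X /\ forall Y, S Y -> F X <= F Y].

End Optimization.

Section Matrices.
Variables n r : nat.
Implicit Types (X Y Z : 'M[R]_(n, r)) (v : 'cV[R]_n) (S : set 'M[R]_(n, r)).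

(* The norm `|X| that MathComp-Analysis puts on matrices is the entrywise
   maximum, so the Frobenius and entrywise l1 norms are introduced here. *)
Definition fro_norm X : R := Num.sqrt (\sum_i \sum_j X i j ^+ 2).

Definition l1_norm X : R := \sum_i \sum_j `|X i j|.

(* [inf set0 = 0], so a distance is only meaningful for a nonempty [S]. *)
Definition dist (N : 'M[R]_(n, r) -> R) X S : R := inf [set N (Z - X) | Z in S].

Definition fro_dist := dist fro_norm.

Definition l1_dist := dist l1_norm.

Definition Bv v : set 'M[R]_(n, r) :=
  [set X | X^T *m X = 1%:M /\ X^T *m v = 0].

Definition Lambda : set 'M[R]_(n, r) :=
  [set X | forall i j, `|X i j| <= (Num.sqrt n%:R)^-1].

Definition binary_feasible v : set 'M[R]_(n, r) :=
  [set B : 'M[R]_(n, r) | [/\ forall i j, B i j = -1 \/ B i j = 1,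
              B^T *m B = n%:R%:M & B^T *m v = 0]].

Definition hpen X : R := l1_dist X Lambda.

Lemma hpenE X :
  hpen X = \sum_i \sum_j Num.max 0 (`|X i j| - (Num.sqrt n%:R)^-1).
Proof.
rewrite /hpen /l1_dist /dist; set a := (Num.sqrt _)^-1; set h := (RHS).
have a0 : 0 <= a by rewrite invr_ge0 sqrtr_ge0.
have lb : lbound [set l1_norm (Z - X) | Z in Lambda] h.
  move=> _ [Z ZL <-]; apply: ler_sum => i _; apply: ler_sum => j _.
  rewrite !mxE ge_max normr_ge0 /= lerBlDr.
  have := ler_normB (Z i j) (Z i j - X i j); rewrite subKr.
  by have := ZL i j; rewrite -/a; lra.
pose Z := \matrix_(i, j) Num.max (- a) (Num.min a (X i j)) : 'M[R]_(n, r).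
have ZL : Lambda Z.
  move=> i j; rewrite mxE -/a ler_norml le_max lexx /= ge_max ge_min lexx.
  by rewrite andbT; lra.
have hZ : l1_norm (Z - X) = h.
  apply: eq_bigr => i _; apply: eq_bigr => j _; rewrite !mxE -/a.
  case: (lerP a (X i j)) => aX.
    have -> : Num.max (- a) a = a by apply/max_idPr; lra.
    have X0 : 0 <= X i j by lra.
    by rewrite (ger0_norm X0) ler0_norm ?max_r; lra.
  case: (lerP (- a) (X i j)) => Xa.
    by rewrite subrr normr0 max_l // subr_le0 ler_norml Xa ltW.
  have X0 : X i j <= 0 by lra.
  by rewrite (ler0_norm X0) ger0_norm ?max_r; lra.
apply/eqP; rewrite eq_le; apply/andP; split.
  by rewrite -hZ; apply: ge_inf; [exists h | exists Z].
by apply: lb_le_inf => //; exists h, Z.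
Qed.

(* The least Lipschitz constant of [f] on [S] with respect to the Frobenius
   norm; as an infimum it is only meaningful when [f] is Lipschitz on [S], as
   a continuously differentiable [f] is on the compact set [Bv v]. *)
Definition lip_modulus (f : 'M[R]_(n, r) -> R) S : R :=
  inf [set L | 0 <= L /\
    forall X Y, S X -> S Y -> `|f X - f Y| <= L * fro_norm (X - Y)].

(* Continuity of X |-> 'd f X is continuity in operator norm; the choice of
   norm on the finite-dimensional space of matrices is immaterial. *)
Definition cont_differentiable (f : 'M[R]_(n, r) -> R) : Prop :=
  (forall X, differentiable f X) /\
  (forall X (e : R), 0 < e ->
     \forall Y \near X, forall D, `|'d f Y D - 'd f X D| <= e * `|D|).

End Matrices.
End Definitions.

Arguments Bv {R n} r v.
Arguments Lambda R n r : clear implicits.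
Arguments binary_feasible {R n} r v.

(* Main.v *)
(* The inequality: if Z is a point of Bv `&` Lambda nearest to X, then
   f X >= f Z - Lf |Z - X| >= fstar - kappa Lf dist(X, Lambda), and the Frobenius
   distance to Lambda is at most the l1 distance hpen X.  This settles the
   equality of the solution sets for rho > kappa Lf.

   At the threshold rho = kappa Lf one must exclude a minimiser X outside Lambda.
   For such an X all the inequalities above are equalities; with a = 1 / sqrt n,
   this means that exactly one entry of X, say (i0, j0), exceeds a in absolute
   value, by e > 0 say, and that |Z - X| = kappa e for the nearest points Z.
   Since f is differentiable, the two minorants fstar - Lf |Z - Y| and
   fstar - kappa Lf dist(Y, Lambda) of f, both touching f at X, have the same
   derivative along Bv.  This first-order condition is contradicted as follows.
   - Every column of X other than j0 is a unit vector with entries at most a, so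
     its entries are +-a.  Applied to the rotations of column j0 with the other
     columns, and combined with kappa^2 >= 5 (valid for r >= 2), the first-order
     condition gives 2 e >= a (r - 1).
   - Hence more than r entries of column j0 differ from +-a, which leaves room for
     a unit vector q orthogonal to v and to the columns of X and whose entries do
     not increase |X i j0| at the entries equal to +-a.
   - Rotating column j0 slightly towards q gives a point Y of Bv whose only
     excess entry is (i0, j0).  By the first-order condition the first-order
     terms of |Z - Y|^2 and kappa^2 dist(Y, Lambda)^2 cancel, and the second-order
     terms make the former larger for every Z, contradicting the error bound. *)

Require Import Defs.
From HB Require Import structures.
From mathcomp Require Import all_boot all_order all_algebra.
From mathcomp Require Import all_classical all_reals all_analysis.
From mathcomp Require Import ring lra.

Set Implicit Arguments.
Unset Strict Implicit.
Unset Printing Implicit Defensive.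

Import Order.TTheory GRing.Theory Num.Theory.
Import numFieldNormedType.Exports.

Local Open Scope classical_set_scope.
Local Open Scope ring_scope.

(** * Lipschitz bound for continuously differentiable functions *)

Lemma mx_norm_leP (R : realType) n r (X : 'M[R]_(n, r)) (b : R) :
  0 <= b -> (`|X| <= b) <-> (forall i j, `|X i j| <= b).
Proof.
move=> b0; rewrite [X in X <= _ <-> _]/Num.norm /= mx_normrE; split.
  by move=> /bigmax_leP[_ Xb] i j; exact: (Xb (i, j)).
by move=> Xb; apply/bigmax_leP; split=> // -[i j] _; exact: Xb.
Qed.

Lemma mx_norm_fro (R : realType) n r (X : 'M[R]_(n, r)) : `|X| <= fro_norm X.
Proof.
apply/mx_norm_leP; first exact: sqrtr_ge0.
move=> i j; rewrite -sqrtr_sqr ler_wsqrtr // (bigD1 i) //= (bigD1 j) //=.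
rewrite -addrA lerDl addr_ge0 // sumr_ge0 // => k _; first exact: sqr_ge0.
by apply: sumr_ge0 => l _; exact: sqr_ge0.
Qed.

(** [vec_mx] maps a product of segments, which is compact, continuously onto the box. *)
Lemma mx_box_compact (R : realType) n r (b : R) :
  compact [set X : 'M[R]_(n, r) | forall i j, `|X i j| <= b].
Proof.
have cK : compact [set w : 'rV[R]_(n * r) | forall k, `[- b, b]%classic (w 0 k)].
  by apply: (@rV_compact _ _ (fun=> `[- b, b]%classic)) => _; exact: segment_compact.
have cv : continuous (@vec_mx R n r).
  move=> w A /= /nbhs_ballP [e e0 eA].
  apply/nbhs_ballP; exists e => //= w' [_ ww']; apply: eA; split => // i j.
  by rewrite !mxE; exact: ww'.
have -> : [set X : 'M[R]_(n, r) | forall i j, `|X i j| <= b] =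
    [set vec_mx w | w in [set w : 'rV[R]_(n * r) |
      forall k, `[- b, b]%classic (w 0 k)]].
  apply/seteqP; split => [X Xb|_ [w wb <-] i j].
    exists (mxvec X); last by rewrite mxvecK.
    by move=> k; case/mxvec_indexP: k => i j; rewrite mxvecE /= in_itv /= -ler_norml.
  by rewrite !mxE ler_norml; have := wb (mxvec_index i j); rewrite /= in_itv.
by apply: continuous_compact => //; exact: continuous_subspaceT.
Qed.

(** Near each point continuity of the differential gives the bound [1 + C]; compactness of the box
    lets one [M] serve everywhere. *)
Lemma diff_bounded_box (R : realType) n r (f : 'M[R]_(n, r) -> R) (b : R) :
  cont_differentiable f ->
  exists2 M, 0 <= M & forall X : 'M[R]_(n, r),
    (forall i j, `|X i j| <= b) -> forall D, `|'d f X D| <= M * `|D|.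
Proof.
move=> [df cf].
pose K : set 'M[R]_(n, r) := [set X | forall i j, `|X i j| <= b].
have /compact_near_coveringP nc := @mx_box_compact R n r b.
have : \forall M \near +oo, K `<=` (fun X => forall D, `|'d f X D| <= M * `|D|).
  apply: nc => X KX.
  have [C C0 CX] : exists2 C, 0 < C & forall D, `|'d f X D| <= C * `|D|.
    exact: linear_lipschitz (diff_continuous (df X)).
  near=> Y M => D.
  have YX : forall D, `|'d f Y D - 'd f X D| <= 1 * `|D|.
    near: Y; apply: cf; exact: ltr01.
  have MC : 1 + C <= M by near: M; apply: nbhs_pinfty_ge; rewrite num_real.
  rewrite -(subrK ('d f X D) ('d f Y D)).
  apply: (le_trans (ler_normD _ _)).
  apply: (le_trans (lerD (YX D) (CX D))).
  by rewrite -mulrDl ler_wpM2r.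
move=> [M [_ MK]]; exists (`|M| + 1); first exact: addr_ge0.
move=> X KX; apply: MK KX.
by rewrite (le_lt_trans (ler_norm _)) // ltrDl.
Unshelve. all: by end_near. Qed.

(** Mean value theorem on the segment from [Y] to [X]. The box is convex and contains this segment,
    which [Bv] in general does not. *)
Lemma cont_differentiable_lipschitz_box (R : realType) n r
    (f : 'M[R]_(n, r) -> R) (b : R) :
  cont_differentiable f ->
  exists2 M, 0 <= M & forall X Y : 'M[R]_(n, r),
    (forall i j, `|X i j| <= b) -> (forall i j, `|Y i j| <= b) ->
    `|f X - f Y| <= M * fro_norm (X - Y).
Proof.
move=> cdf; have [df _] := cdf; have [M M0 MK] := diff_bounded_box b cdf.
exists M => // X Y Xb Yb.
pose g (t : R) : 'M[R]_(n, r) := Y + t *: (X - Y).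
have dg (t : R) : is_diff t g ( *:%R^~ (X - Y)).
  have := is_diffD (is_diff_cst Y t) (is_diff_scalel t (X - Y)).
  by rewrite add0r.
have dfg (t : R) : is_derive t (1 : R) (f \o g) ('d f (g t) (X - Y)).
  have df_g : is_diff (g t) f ('d f (g t)) by exact: DiffDef.
  have dc := is_diff_comp (dg t) df_g.
  apply: DeriveDef; first by apply: diff_derivable.
  by rewrite deriveE // diff_val /= scale1r.
have [//|c c01] := @MVT R (f \o g) (fun t => 'd f (g t) (X - Y)) 0 1 ltr01 (fun t _ => dfg t).
  apply: continuous_subspaceT => t; apply: differentiable_continuous.
  by apply/derivable1_diffP; have [] := dfg t.
rewrite /g /= scale1r scale0r addr0 subr0 mulr1 [Y + _]addrC subrK => ->.
apply: le_trans (_ : M * `|X - Y| <= _); last by rewrite ler_wpM2l // mx_norm_fro.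
apply: MK => i j; rewrite !mxE.
move: c01; rewrite in_itv /= => /andP[c0 c1].
have -> : Y i j + c * (X i j - Y i j) = (1 - c) * Y i j + c * X i j by ring.
rewrite (le_trans (ler_normD _ _)) // !normrM (ger0_norm (ltW c0)).
have c1' : 0 <= 1 - c by rewrite subr_ge0 ltW.
rewrite (ger0_norm c1').
have := ler_wpM2l c1' (Yb i j); have := ler_wpM2l (ltW c0) (Xb i j).
lra.
Qed.

(** * Frobenius product and rotations inside [Bv] *)

Definition frodot (R : realType) n r (X Y : 'M[R]_(n, r)) : R := \tr (X^T *m Y).

Section Frobenius.
Variables (R : realType) (n r : nat).
Implicit Types X Y Z D : 'M[R]_(n, r).

Lemma frodotE X Y : frodot X Y = \sum_i \sum_j X i j * Y i j.
Proof.
rewrite exchange_big /=; apply: eq_bigr => j _.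
by rewrite !mxE; apply: eq_bigr => i _; rewrite !mxE.
Qed.

Lemma frodotC X Y : frodot X Y = frodot Y X.
Proof. by rewrite /frodot -mxtrace_tr trmx_mul trmxK. Qed.

Lemma frodotDl X Y Z : frodot (X + Y) Z = frodot X Z + frodot Y Z.
Proof. by rewrite /frodot linearD mulmxDl mxtraceD. Qed.

Lemma frodotZl c X Y : frodot (c *: X) Y = c * frodot X Y.
Proof. by rewrite /frodot linearZ -scalemxAl mxtraceZ. Qed.

Lemma frodotNl X Y : frodot (- X) Y = - frodot X Y.
Proof. by rewrite -scaleN1r frodotZl mulN1r. Qed.

Lemma frodotDr X Y Z : frodot X (Y + Z) = frodot X Y + frodot X Z.
Proof. by rewrite 3![frodot X _]frodotC frodotDl. Qed.

Lemma frodotNr X Y : frodot X (- Y) = - frodot X Y.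
Proof. by rewrite 2![frodot X _]frodotC frodotNl. Qed.

Lemma fro_norm_ge0 X : 0 <= fro_norm X.
Proof. exact: sqrtr_ge0. Qed.

Lemma sqr_fro_norm X : fro_norm X ^+ 2 = frodot X X.
Proof.
rewrite sqr_sqrtr; last first.
  by apply: sumr_ge0 => i _; apply: sumr_ge0 => j _; exact: sqr_ge0.
by rewrite frodotE; apply: eq_bigr => i _; apply: eq_bigr => j _; rewrite expr2.
Qed.

Lemma fro_normN X : fro_norm (- X) = fro_norm X.
Proof.
congr Num.sqrt; apply: eq_bigr => i _; apply: eq_bigr => j _.
by rewrite mxE sqrrN.
Qed.

Lemma fro_distC X Y : fro_norm (X - Y) = fro_norm (Y - X).
Proof. by rewrite -fro_normN opprB. Qed.

Lemma sqr_fro_normB X Y :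
  fro_norm (X - Y) ^+ 2 = frodot X X + frodot Y Y - 2 * frodot X Y.
Proof.
rewrite sqr_fro_norm !frodotDl !frodotDr !frodotNl !frodotNr (frodotC Y X).
by ring.
Qed.

Lemma sqr_fro_norm_cols X :
  fro_norm X ^+ 2 = \sum_j \sum_i X i j ^+ 2.
Proof.
rewrite sqr_fro_norm frodotE exchange_big /=.
by apply: eq_bigr => j _; apply: eq_bigr => i _; rewrite expr2.
Qed.

End Frobenius.

Section Stiefel.
Variables (R : realType) (n r : nat) (v : 'cV[R]_n).
Implicit Types X Y Z D : 'M[R]_(n, r).

Lemma Bv_frodot X : Bv r v X -> frodot X X = r%:R.
Proof. by move=> [XX _]; rewrite /frodot XX mxtrace1. Qed.

Lemma Bv_sqr_dist X Y : Bv r v X -> Bv r v Y ->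
  fro_norm (X - Y) ^+ 2 = 2 * r%:R - 2 * frodot X Y.
Proof. by move=> BX BY; rewrite sqr_fro_normB !(Bv_frodot BX, Bv_frodot BY); ring. Qed.

Lemma Bv_cols X (j k : 'I_r) : Bv r v X ->
  \sum_i X i j * X i k = (j == k)%:R.
Proof.
move=> [XX _]; have /matrixP/(_ j k) := XX; rewrite !mxE => <-.
by apply: eq_bigr => i _; rewrite mxE.
Qed.

Lemma Bv_col_norm X j : Bv r v X -> \sum_i X i j ^+ 2 = 1.
Proof.
move=> BX; have := Bv_cols j j BX; rewrite eqxx mulr1n => XX; rewrite -[RHS]XX.
by apply: eq_bigr => i _; rewrite expr2.
Qed.

Lemma Bv_entry_le1 X i j : Bv r v X -> `|X i j| <= 1.
Proof.
move=> /Bv_col_norm XX; rewrite -(@ler_pXn2r _ 2) ?nnegrE // expr1n.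
rewrite real_normK ?num_real // -(XX j) (bigD1 i) //= lerDl.
by apply: sumr_ge0 => k _; exact: sqr_ge0.
Qed.

(** [J = D^T D] is an orthogonal projection and the new point is [X (1 - J) + c X J + s D]: the part
    of [X] on the range of [J] turns towards [D]. The Gram matrix changes by
    [(c ^+ 2 + s ^+ 2 - 1) J]. *)
Lemma Bv_rotate X D c s :
  Bv r v X -> D *m (D^T *m D) = D -> X^T *m D + D^T *m X = 0 -> D^T *m v = 0 ->
  c ^+ 2 + s ^+ 2 = 1 ->
  Bv r v (X + s *: D - (1 - c) *: (X *m (D^T *m D))).
Proof.
move=> [XX Xv] DDD XD Dv cs.
set J := D^T *m D; have JT : J^T = J by rewrite trmx_mul trmxK.
have DTX : D^T *m X = - (X^T *m D) by apply/eqP; rewrite -addr_eq0 addrC XD.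
have JJ : J *m J = J by rewrite {1}/J -mulmxA DDD.
have JDT : J *m D^T = D^T by rewrite -{1}JT -trmx_mul DDD.
(* The skew matrix X^T D is supported on the range of J. *)
have JXD : J *m (X^T *m D) = X^T *m D.
  have -> : X^T *m D = - (D^T *m X) by rewrite DTX opprK.
  by rewrite mulmxN mulmxA JDT.
have XDJ : X^T *m D *m J = X^T *m D by rewrite -mulmxA DDD.
split.
  have e1 : J *m X^T *m X = J by rewrite -mulmxA XX mulmx1.
  have e2 : J *m X^T *m D = X^T *m D by rewrite -mulmxA JXD.
  have e3 : X^T *m (X *m J) = J by rewrite mulmxA XX mul1mx.
  have e4 : D^T *m (X *m J) = - (X^T *m D) by rewrite mulmxA DTX mulNmx XDJ.
  have e5 : J *m X^T *m (X *m J) = J by rewrite mulmxA e1.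
  have -> : (X + s *: D - (1 - c) *: (X *m J))^T =
      X^T + s *: D^T - (1 - c) *: (J *m X^T).
    by rewrite linearB linearD !linearZ /= trmx_mul JT.
  rewrite !(mulmxDl, mulmxDr, mulNmx, mulmxN) -!(scalemxAl, scalemxAr).
  rewrite XX e1 e2 e3 e4 e5 DTX -/J.
  move: J (X^T *m D) {JT DTX JJ JDT JXD XDJ e1 e2 e3 e4 e5} => J O.
  apply/matrixP => i j; rewrite !mxE /=; apply/eqP; rewrite -subr_eq0.
  set x := J i j; set o := (i == j)%:R.
  rewrite (_ : _ - _ = (c ^+ 2 + s ^+ 2 - 1) * x); last by ring.
  by rewrite cs subrr mul0r.
rewrite linearB linearD !linearZ /= trmx_mul JT !(mulmxDl, mulmxBl, mulNmx).
by rewrite -!scalemxAl Dv mulNmx -(mulmxA J) Xv mulmx0 oppr0 !scaler0 !addr0.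
Qed.

End Stiefel.

(* Along t |-> X + sin t D - (1 - cos t) V, of velocity D at X, only the term in b
   contributes to the first order. *)
Lemma fermat_rotate (R : realType) n r (f : 'M[R]_(n, r) -> R) X D V
    (b g m b' g' : R) :
  (forall Y, differentiable f Y) ->
  (forall c s, c ^+ 2 + s ^+ 2 = 1 ->
     f X <= f (X + s *: D - (1 - c) *: V)
            + b * s + g * (1 - c) + m * (b' * s + g' * (1 - c)) ^+ 2) ->
  'd f X D = - b.
Proof.
move=> df fX.
pose y (t : R) : 'M[R]_(n, r) := X + sin t *: D - (1 - cos t) *: V.
pose y' (t : R) : 'M[R]_(n, r) := cos t *: D - sin t *: V.
have dy (t : R) : is_derive t (1 : R) y (y' t).
  have dyij i j : is_derive t (1 : R) (fun t => y t i j) (y' t i j).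
    rewrite (_ : (fun t => y t i j) =
      (fun t => X i j + sin t * D i j - (1 - cos t) * V i j)); last first.
      by apply/funext => u; rewrite !mxE.
    by apply: is_derive_eq; rewrite !mxE /GRing.scale /=; ring.
  apply: DeriveDef.
    by apply/derivable_mxP => i j; have [] := dyij i j.
  rewrite derive_mx; last by apply/derivable_mxP => i j; have [] := dyij i j.
  by apply/matrixP => i j; rewrite mxE; have [_ ->] := dyij i j.
pose h (t : R) := b * sin t + g * (1 - cos t) +
     m * (b' * sin t + g' * (1 - cos t)) ^+ 2.
have dh (t : R) : is_derive t (1 : R) h
   (b * cos t + g * sin t + m * (2 * (b' * sin t + g' * (1 - cos t))
     * (b' * cos t + g' * sin t))).
  by apply: is_derive_eq; rewrite /GRing.scale /=; ring.
have dfy (t : R) : is_derive t (1 : R) (f \o y) ('d f (y t) (y' t)).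
  have dyt : differentiable y t by apply/derivable1_diffP; have [] := dy t.
  apply: DeriveDef.
    by apply: diff_derivable; apply: differentiable_comp.
  rewrite deriveE; last exact: differentiable_comp.
  rewrite diff_comp //=; congr ('d f _ _).
  by rewrite -deriveE //; have [_ ->] := dy t.
have dF (t : R) := is_deriveD (dfy t) (dh t).
(* The sum is minimal at 0, where [h] vanishes and has derivative [b]. *)
have : is_derive (0 : R) (1 : R) ((f \o y) + h) 0.
  have i0 : (0 : R) \in `]-1, 1[ by rewrite in_itv /= ltrN10 ltr01.
  apply: derive1_at_min (i0) _.
  - by rewrite (le_trans (ltW (ltrN10 _))).
  - by move=> t _; have [] := dF t.
  - move=> t _; rewrite /= !fctE /= /h /y sin0 cos0 subrr !mulr0 scale0r.
    rewrite scale0r subr0 !addr0 expr0n mulr0 addr0 addrA addrA.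
    by rewrite addr0; apply: fX; rewrite cos2Dsin2.
move=> [_ D0]; have [_] := dF 0; rewrite D0 /y' /y sin0 cos0 subrr !mulr0.
rewrite !scale0r scale1r !subr0 !addr0 mulr1 !mulr0 mul0r mulr0 addr0.
by move/esym/eqP; rewrite addr_eq0 => /eqP.
Qed.

(** * Excess over [Lambda] and feasible points *)

Lemma finite_uniform_pos (R : realType) (T : finType) (P : T -> R -> Prop) :
  (forall t, exists2 d, 0 < d & forall e, 0 < e -> e <= d -> P t e) ->
  exists2 e, 0 < e & forall t, P t e.
Proof.
move=> PT; have /choice[d dP] : forall t, exists d, 0 < d /\
    forall e, 0 < e -> e <= d -> P t e.
  by move=> t; have [d d0 dt] := PT t; exists d.
exists (\big[Num.min/1]_t d t) => [|t].
  by apply: lt_bigmin => // t _; have [] := dP t.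
have [_] := dP t; apply; last exact: bigmin_le_cond.
by apply: lt_bigmin => // u _; have [] := dP u.
Qed.

(** The summands of [hpenE]: [hpen] is the l1 norm of this array, and its l2 norm bounds the
    Frobenius distance to [Lambda]. *)
Definition excess (R : realType) n r (X : 'M[R]_(n, r)) i j : R :=
  Num.max 0 (`|X i j| - (Num.sqrt n%:R)^-1).

Section Excess.
Variables (R : realType) (n r : nat).
Implicit Types X Y Z : 'M[R]_(n, r).
Local Notation a := (Num.sqrt n%:R : R)^-1.

Lemma excess_ge0 X i j : 0 <= excess X i j.
Proof. by rewrite le_max lexx. Qed.

Lemma excess_eq0 X i j : `|X i j| <= a -> excess X i j = 0.
Proof. by move=> Xa; rewrite /excess max_l // subr_le0. Qed.

Lemma excess_sum_ge0 X : 0 <= \sum_i \sum_j excess X i j.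
Proof. by apply: sumr_ge0 => i _; apply: sumr_ge0 => j _; exact: excess_ge0. Qed.

Lemma excess_sumsq_ge0 X : 0 <= \sum_i \sum_j excess X i j ^+ 2.
Proof. by apply: sumr_ge0 => i _; apply: sumr_ge0 => j _; exact: sqr_ge0. Qed.

Lemma excess_lipschitz X Y i j : excess Y i j <= excess X i j + `|Y i j - X i j|.
Proof.
rewrite {1}/excess ge_max addr_ge0 ?excess_ge0 //=.
have : `|X i j| - a <= excess X i j by rewrite le_max lexx orbT.
have := ler_normD (X i j) (Y i j - X i j); rewrite addrC subrK; lra.
Qed.

Lemma fro_dist_Lambda_le X :
  fro_dist X (Lambda R n r) <= Num.sqrt (\sum_i \sum_j excess X i j ^+ 2).
Proof.
have a0 : 0 <= a by rewrite invr_ge0 sqrtr_ge0.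
pose Z : 'M[R]_(n, r) := \matrix_(i, j) Num.max (- a) (Num.min a (X i j)).
have ZL : Lambda R n r Z.
  move=> i j; rewrite mxE ler_norml le_max lexx /= ge_max ge_min lexx.
  by rewrite andbT; lra.
have ZX : fro_norm (Z - X) <= Num.sqrt (\sum_i \sum_j excess X i j ^+ 2).
  apply: ler_wsqrtr; apply: ler_sum => i _; apply: ler_sum => j _.
  rewrite -real_normK ?num_real // ler_pXn2r ?nnegrE ?excess_ge0 //.
  rewrite !mxE /excess le_max; case: (lerP a (X i j)) => aX.
    have -> : Num.max (- a) a = a by apply/max_idPr; lra.
    have X0 : 0 <= X i j by lra.
    by rewrite (ger0_norm X0) distrC ger0_norm ?lexx ?orbT //; lra.
  case: (lerP (- a) (X i j)) => Xa; first by rewrite subrr normr0 lexx.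
  have X0 : X i j <= 0 by lra.
  rewrite (ler0_norm X0) ger0_norm; last lra.
  by apply/orP; right; lra.
apply: le_trans ZX; apply: ge_inf; last by exists Z.
by exists 0 => _ [W _ <-]; exact: fro_norm_ge0.
Qed.

Lemma excess_le_sum X i j : excess X i j <= \sum_k \sum_l excess X k l.
Proof.
rewrite (bigD1 i) //= (bigD1 j) //= -addrA lerDl addr_ge0 // sumr_ge0 // => *.
  exact: excess_ge0.
by apply: sumr_ge0 => *; exact: excess_ge0.
Qed.

Lemma sqrt_excess_le X :
  Num.sqrt (\sum_i \sum_j excess X i j ^+ 2) <= \sum_i \sum_j excess X i j.
Proof.
rewrite -[leRHS]ger0_norm ?excess_sum_ge0 // -sqrtr_sqr ler_wsqrtr //.
rewrite [leRHS]expr2 mulr_suml; apply: ler_sum => i _.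
rewrite mulr_suml; apply: ler_sum => j _; rewrite expr2.
by rewrite ler_wpM2l ?excess_ge0 // excess_le_sum.
Qed.

(** With [h] the total, [h ^+ 2] minus the sum of squares is the sum of the nonnegative terms
    [excess * (h - excess)]. So each excess is 0 or [h], and only one can be [h]. *)
Lemma excess_single X : 0 < \sum_i \sum_j excess X i j ->
  \sum_i \sum_j excess X i j <= Num.sqrt (\sum_i \sum_j excess X i j ^+ 2) ->
  exists i0 j0, [/\ 0 < excess X i0 j0,
    excess X i0 j0 = \sum_i \sum_j excess X i j &
    forall i j, (i, j) != (i0, j0) -> `|X i j| <= a].
Proof.
set h := \sum_i \sum_j excess X i j => h0 hle.
have h2 : \sum_i \sum_j excess X i j * (h - excess X i j) <= 0.
  have -> : \sum_i \sum_j excess X i j * (h - excess X i j) =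
      h ^+ 2 - \sum_i \sum_j excess X i j ^+ 2.
    rewrite expr2 {2}/h mulr_suml -sumrB; apply: eq_bigr => i _.
    rewrite mulr_suml -sumrB; apply: eq_bigr => j _; ring.
  rewrite subr_le0 -(sqr_sqrtr (excess_sumsq_ge0 X)).
  by rewrite ler_pXn2r ?nnegrE ?sqrtr_ge0 // ltW.
have ex0 i j : excess X i j = 0 \/ excess X i j = h.
  have t0 k l : 0 <= excess X k l * (h - excess X k l).
    by rewrite mulr_ge0 ?excess_ge0 // subr_ge0 excess_le_sum.
  have : excess X i j * (h - excess X i j) <= 0.
    apply: le_trans h2; rewrite (bigD1 i) //= (bigD1 j) //= -addrA lerDl.
    by rewrite addr_ge0 // sumr_ge0 // => k _; apply: sumr_ge0.
  have := t0 i j => t1 t2; have /eqP : excess X i j * (h - excess X i j) = 0.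
    by apply/eqP; rewrite eq_le t2 t1.
  by rewrite mulf_eq0 subr_eq0 => /orP[/eqP|/eqP ->]; [left|right].
have [i0 [j0 ij0]] : exists i0 j0, 0 < excess X i0 j0.
  apply: contrapT => nex; move: h0; rewrite /h big1 ?ltxx // => i _.
  rewrite big1 // => j _; apply/eqP; rewrite eq_le excess_ge0 andbT leNgt.
  by apply/negP => ?; apply: nex; exists i, j.
exists i0, j0; have e0 : excess X i0 j0 = h.
  by have [e0|//] := ex0 i0 j0; rewrite e0 ltxx in ij0.
split=> // i j ij; suff : excess X i j <= 0.
  by rewrite /excess ge_max lexx /= subr_le0.
have : excess X i j + excess X i0 j0 <= h; last by rewrite e0; lra.
rewrite /h pair_big /= (bigD1 (i, j)) //= (bigD1 (i0, j0)) 1?eq_sym //=.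
rewrite addrA lerDl; apply: sumr_ge0 => *; exact: excess_ge0.
Qed.

End Excess.

Section Feasible.
Variables (R : realType) (n r : nat) (v : 'cV[R]_n).
Hypothesis n0 : (0 < n)%N.
Implicit Types X Y Z : 'M[R]_(n, r).
Local Notation a := (Num.sqrt n%:R : R)^-1.
Local Notation feasible := (Bv r v `&` Lambda R n r).

Lemma inv_sqrt_gt0 : 0 < a.
Proof. by rewrite invr_gt0 sqrtr_gt0 ltr0n. Qed.

Lemma sqr_inv_sqrt : n%:R * a ^+ 2 = 1.
Proof. by rewrite exprVn sqr_sqrtr ?ler0n // divff // pnatr_eq0 -lt0n. Qed.

(** Since [n * a ^+ 2 = 1], the nonnegative terms [a ^+ 2 - X k j ^+ 2] sum to 0. *)
Lemma unit_col_saturated X j : Bv r v X -> (forall i, `|X i j| <= a) ->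
  forall i, `|X i j| = a.
Proof.
move=> BX Xa i; have a0 := inv_sqrt_gt0.
have d0 k : 0 <= a ^+ 2 - X k j ^+ 2.
  by rewrite subr_ge0 -(real_normK (num_real (X k j))) ler_pXn2r ?nnegrE // ltW.
have : \sum_k (a ^+ 2 - X k j ^+ 2) = 0.
  rewrite sumrB (Bv_col_norm j BX) sumr_const card_ord -[_ *+ n]mulr_natl sqr_inv_sqrt.
  by rewrite subrr.
move/psumr_eq0P => /(_ (fun k _ => d0 k) i isT)/eqP; rewrite subr_eq0.
by rewrite -(real_normK (num_real (X i j))) eqrXn2 ?(ltW a0) // => /eqP ->.
Qed.

Lemma feasible_entry Z i j : feasible Z -> `|Z i j| = a.
Proof. by move=> [BZ LZ]; apply: unit_col_saturated. Qed.

(** Feasible points have entries [a] or [- a], so boolean matrices enumerate them and minima over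
    feasible points become minima over a finite type. *)
Definition sign_mx (b : 'M[bool]_(n, r)) : 'M[R]_(n, r) :=
  \matrix_(i, j) if b i j then a else - a.

Lemma feasible_sign_mx Z : feasible Z -> exists b, Z = sign_mx b.
Proof.
move=> FZ; exists (\matrix_(i, j) (0 <= Z i j)); apply/matrixP => i j.
rewrite !mxE -(feasible_entry i j FZ); case: ger0P => // _.
by rewrite opprK.
Qed.

Lemma feasible_min (g : 'M[R]_(n, r) -> R) : feasible !=set0 ->
  exists2 Z, feasible Z & forall Z', feasible Z' -> g Z <= g Z'.
Proof.
move=> [Z0 FZ0]; have [b0 Z0b] := feasible_sign_mx FZ0.
pose P b := `[< feasible (sign_mx b) >].
have Pb0 : P b0 by apply/asboolP; rewrite -Z0b.
case: (@arg_minP _ _ _ b0 P (g \o sign_mx) Pb0) => b /asboolP Fb bmin.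
exists (sign_mx b) => // Z' FZ'; have [b' Zb'] := feasible_sign_mx FZ'.
by rewrite Zb'; apply: bmin; apply/asboolP; rewrite -Zb'.
Qed.

Lemma feasible_uniform_pos (P : 'M[R]_(n, r) -> R -> Prop) :
  (forall Z, feasible Z ->
    exists2 d, 0 < d & forall e, 0 < e -> e <= d -> P Z e) ->
  exists2 e, 0 < e & forall Z, feasible Z -> P Z e.
Proof.
move=> PF.
have [b|e e0 Pe] := @finite_uniform_pos R 'M[bool]_(n, r)
    (fun b e => feasible (sign_mx b) -> P (sign_mx b) e).
  have [/PF[d d0 Pd]|nF] := pselect (feasible (sign_mx b)).
    by exists d => // e e0 ed _; exact: Pd.
  by exists 1.
by exists e => // Z FZ; have [b Zb] := feasible_sign_mx FZ; rewrite Zb; apply: Pe;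
  rewrite -Zb.
Qed.

Lemma feasible_nearest Y : feasible !=set0 ->
  exists2 Z, feasible Z & fro_norm (Z - Y) = fro_dist Y feasible.
Proof.
move=> /(feasible_min (fun Z => fro_norm (Z - Y)))[Z FZ Zmin]; exists Z => //.
apply/eqP; rewrite eq_le; apply/andP; split.
  by apply: lb_le_inf; [exists (fro_norm (Z - Y)), Z | move=> _ [W FW <-]; exact: Zmin].
by apply: ge_inf; [exists 0 => _ [W _ <-]; exact: fro_norm_ge0 | exists Z].
Qed.

Lemma optimal_value_le (f : 'M[R]_(n, r) -> R) Z : feasible Z ->
  optimal_value f feasible <= f Z.
Proof.
move=> FZ; have [|W FW Wmin] := feasible_min f; first by exists Z.
by apply: ge_inf; [exists (f W) => _ [W' FW' <-]; exact: Wmin | exists Z].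
Qed.

Lemma optimal_value_attained (f : 'M[R]_(n, r) -> R) : feasible !=set0 ->
  exists2 Z, feasible Z & f Z = optimal_value f feasible.
Proof.
move=> F0; have [Z FZ Zmin] := feasible_min f F0; exists Z => //.
apply/eqP; rewrite eq_le optimal_value_le // andbT.
by apply: lb_le_inf; [exists (f Z), Z | move=> _ [W FW <-]; exact: Zmin].
Qed.

Lemma binary_feasible_scale B : binary_feasible r v B -> feasible (a *: B).
Proof.
move=> [Bs BB Bv0]; split; last first.
  move=> i j; rewrite mxE normrM ger0_norm ?invr_ge0 ?sqrtr_ge0 //.
  by case: (Bs i j) => ->; rewrite ?normrN normr1 mulr1.
have aB : (a *: B)^T = a *: B^T by rewrite linearZ.
rewrite /Bv /= aB -!scalemxAl -scalemxAr Bv0 scaler0; split => //.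
by rewrite BB scalerA -scalemx1 scalerA -expr2 mulrC sqr_inv_sqrt // scale1r.
Qed.

End Feasible.

(** * The Lipschitz modulus on [Bv] *)

Section LipModulus.
Variables (R : realType) (n r : nat) (v : 'cV[R]_n) (f : 'M[R]_(n, r) -> R).
Hypothesis cdf : cont_differentiable f.

Let lip_set_neq0 : [set L | 0 <= L /\ forall X Y, Bv r v X -> Bv r v Y ->
  `|f X - f Y| <= L * fro_norm (X - Y)] !=set0.
Proof.
(* Columns of points of [Bv] are unit vectors, so the box of half-width 1 contains [Bv]. *)
have [M M0 MK] := cont_differentiable_lipschitz_box 1 cdf.
by exists M; split=> // X Y BX BY; apply: MK => i j; apply: Bv_entry_le1; eassumption.
Qed.

Lemma lip_modulus_ge0 : 0 <= lip_modulus f (Bv r v).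
Proof. by apply: lb_le_inf; [exact: lip_set_neq0 | move=> L []]. Qed.

Lemma lip_modulusP X Y : Bv r v X -> Bv r v Y ->
  `|f X - f Y| <= lip_modulus f (Bv r v) * fro_norm (X - Y).
Proof.
move=> BX BY; have := fro_norm_ge0 (X - Y); rewrite le_eqVlt => /orP[/eqP d0|d0].
  by have [L [_ LP]] := lip_set_neq0; have := LP X Y BX BY; rewrite -d0 !mulr0.
rewrite -ler_pdivrMr //; apply: lb_le_inf; first exact: lip_set_neq0.
by move=> L [_ LP]; rewrite ler_pdivrMr //; exact: LP.
Qed.

End LipModulus.

(** * Rotations of two columns *)

(** A dimension count: [U] embeds the coordinates in [S], and [U *m C] has more rows than columns,
    hence a nonzero left kernel. *)
Lemma supported_kernel (F : fieldType) n m (C : 'M[F]_(n, m)) (S : {set 'I_n}) :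
  (m < #|S|)%N ->
  exists2 q : 'rV[F]_n, q != 0 & q *m C = 0 /\ forall i, i \notin S -> q 0 i = 0.
Proof.
move=> mS.
pose U : 'M[F]_(#|S|, n) := \matrix_(k, i) (enum_val k == i)%:R.
have /rowV0Pn[y] : kermx (U *m C) != 0.
  rewrite -mxrank_eq0 mxrank_ker -lt0n subn_gt0.
  exact: leq_ltn_trans (rank_leq_col _) mS.
move=> /sub_kermxP yUC y0; exists (y *m U); last first.
  split; first by rewrite -mulmxA.
  move=> i iS; rewrite mxE big1 // => k _; rewrite mxE.
  by case: eqP => [ki|]; rewrite ?mulr0 //; rewrite -ki enum_valP in iS.
apply: contra_neq y0 => yU0; apply/rowP => k.
have /rowP/(_ (enum_val k)) := yU0; rewrite !mxE (bigD1 k) //= mxE eqxx mulr1.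
rewrite big1 ?addr0 // => l lk; rewrite mxE (inj_eq enum_val_inj).
by rewrite (negbTE lk) mulr0.
Qed.

Lemma mul_delta_col (R : pzSemiRingType) n m r (W : 'M[R]_(n, m)) j (k : 'I_r) i l :
  (W *m delta_mx j k) i l = W i j * (l == k)%:R.
Proof.
rewrite mxE (bigD1 j) //= mxE eqxx /= big1 ?addr0 // => p pj.
by rewrite mxE (negbTE pj) mulr0.
Qed.

Section Rotations.
Variables (R : realType) (n r : nat) (v : 'cV[R]_n).
Implicit Types X Y Z W D : 'M[R]_(n, r).

(** The velocity of the rotation turning column [k] of [W] towards column [j], and column [j]
    towards minus column [k]. *)
Definition col_rot W (j k : 'I_r) : 'M[R]_(n, r) :=
  W *m (delta_mx j k - delta_mx k j).

Lemma col_rotE W j k i l :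
  col_rot W j k i l = W i j * (l == k)%:R - W i k * (l == j)%:R.
Proof. by rewrite /col_rot mulmxBr [LHS]mxE [X in _ + X]mxE !mul_delta_col. Qed.

Lemma trmx_delta_skew (j k : 'I_r) :
  (delta_mx j k - delta_mx k j)^T = delta_mx k j - delta_mx j k :> 'M[R]_r.
Proof. by rewrite linearB /= !trmx_delta. Qed.

Lemma col_rot_gram W j k : j != k -> Bv r v W ->
  (col_rot W j k)^T *m col_rot W j k = delta_mx j j + delta_mx k k.
Proof.
move=> jk [WW _]; rewrite trmx_mul -mulmxA (mulmxA W^T) WW mul1mx.
rewrite trmx_delta_skew mulmxBl !mulmxBr !mul_delta_mx_cond !eqxx.
by rewrite (negbTE jk) eq_sym (negbTE jk) !mulr0n !mulr1n subr0 sub0r opprK addrC.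
Qed.

(** The conditions that [Bv_rotate] imposes on its direction. *)
Lemma col_rot_tangent W j k : j != k -> Bv r v W ->
  let D := col_rot W j k in
  [/\ D *m (D^T *m D) = D, W^T *m D + D^T *m W = 0 & D^T *m v = 0].
Proof.
move=> jk BW D; have [WW Wv] := BW; split.
- rewrite /D col_rot_gram // -mulmxA; congr (_ *m _).
  rewrite mulmxBl !mulmxDr !mul_delta_mx_cond !eqxx.
  by rewrite (negbTE jk) eq_sym (negbTE jk) !mulr0n !mulr1n addr0 add0r.
- rewrite trmx_mul mulmxA WW mul1mx -mulmxA WW mulmx1 trmx_delta_skew.
  by rewrite addrC subrKA subrr.
- by rewrite trmx_mul -mulmxA Wv mulmx0.
Qed.

Lemma col_rot_entry W j k c s i l : j != k -> Bv r v W ->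
  (W + s *: col_rot W j k - (1 - c) *:
     (W *m ((col_rot W j k)^T *m col_rot W j k))) i l =
  if l == k then c * W i k + s * W i j
  else if l == j then c * W i j - s * W i k else W i l.
Proof.
move=> jk BW; rewrite col_rot_gram // mulmxDr.
have := col_rotE W j k i l; have := mul_delta_col W j j i l.
have := mul_delta_col W k k i l.
move: (col_rot W j k) (W *m delta_mx j j) (W *m delta_mx k k) => D A B hB hA hD.
rewrite !mxE hB hA hD.
case: eqP => [->|_]; first by rewrite eq_sym (negbTE jk) /=; ring.
by case: eqP => [->|_] /=; ring.
Qed.

Lemma sum_two (F : 'I_r -> R) j k : j != k ->
  (forall l, l != j -> l != k -> F l = 0) -> \sum_l F l = F j + F k.
Proof.
move=> jk F0; rewrite (bigD1 j) //= (bigD1 k) 1?eq_sym //= big1 ?addr0 //.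
by move=> l /andP[]; exact: F0.
Qed.

End Rotations.

(** * A lower bound on the error bound constant *)

Section ErrorBoundConstant.
Variables (R : realType) (n r : nat) (v : 'cV[R]_n) (kappa : R).
Hypothesis n0 : (0 < n)%N.
Local Notation a := (Num.sqrt n%:R : R)^-1.
Local Notation feasible := (Bv r v `&` Lambda R n r).
Local Notation excess_norm Y := (Num.sqrt (\sum_i \sum_j excess Y i j ^+ 2)).
Hypothesis kappa0 : 0 < kappa.
Hypothesis error_bound : forall Y : 'M[R]_(n, r), Bv r v Y ->
  exists2 Z, feasible Z & fro_norm (Z - Y) <= kappa * excess_norm Y.

(* Rotating two columns of a feasible point by the angle with sine 3/5 keeps it
   the nearest feasible point, at squared distance 4/5, with excess 2/5. *)
Lemma sqr_kappa_ge5 Z (j k : 'I_r) : j != k -> feasible Z -> 5 <= kappa ^+ 2.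
Proof.
move=> jk FZ; have [BZ _] := FZ; have a0 := inv_sqrt_gt0 R n0.
have [DDD XD Dv] := col_rot_tangent jk BZ.
have cs : (4 / 5 : R) ^+ 2 + (3 / 5) ^+ 2 = 1 by field.
have := Bv_rotate BZ DDD XD Dv cs.
set Y := Z + _ - _ => BY.
have Yil i l : Y i l = if l == k then 4 / 5 * Z i k + 3 / 5 * Z i j
    else if l == j then 4 / 5 * Z i j - 3 / 5 * Z i k else Z i l.
  exact: col_rot_entry BZ.
have Zab i l : Z i l = a \/ Z i l = - a.
  by have := feasible_entry n0 i l FZ; case: ger0P => _ <-; [left|right; rewrite opprK].
have Yjk i : (`|Y i j| = a / 5 /\ `|Y i k| = 7 * a / 5) \/
             (`|Y i j| = 7 * a / 5 /\ `|Y i k| = a / 5).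
  rewrite !Yil !eqxx (negbTE jk).
  case: (Zab i j) => ->; case: (Zab i k) => ->.
  - by left; split; rewrite ger0_norm; lra.
  - by right; split; [rewrite ger0_norm | rewrite ler0_norm]; lra.
  - by right; split; [rewrite ler0_norm | rewrite ger0_norm]; lra.
  - by left; split; rewrite ler0_norm; lra.
have m1 : Num.max 0 (a / 5 - a) = 0 by rewrite max_l //; lra.
have m2 : Num.max 0 (7 * a / 5 - a) = 2 / 5 * a by rewrite max_r //; lra.
have exY : \sum_i \sum_l excess Y i l ^+ 2 = (2 / 5) ^+ 2.
  transitivity (\sum_(i < n) ((2 / 5) ^+ 2 * a ^+ 2)).
    apply: eq_bigr => i _; rewrite (sum_two jk).
      by rewrite /excess; case: (Yjk i) => -[-> ->]; rewrite m1 m2 expr0n ?addr0 ?add0r exprMn.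
    move=> l lj lk; rewrite excess_eq0 ?expr0n //.
    by rewrite Yil (negbTE lj) (negbTE lk) (feasible_entry n0 _ _ FZ).
  by rewrite sumr_const card_ord -[_ *+ n]mulr_natl mulrCA sqr_inv_sqrt // mulr1.
(* Each row of [Y] has l1 norm [r * a - 2 * a / 5], and the entries of [Z'] have modulus [a]. *)
have dY Z' : feasible Z' -> frodot Y Z' <= r%:R - 2 / 5.
  move=> FZ'.
  apply: (@le_trans _ _ (\sum_i \sum_l `|Y i l| * a)).
    rewrite frodotE; apply: ler_sum => i _; apply: ler_sum => l _.
    by rewrite -(feasible_entry n0 i l FZ') -normrM ler_norm.
  have -> : r%:R - 2 / 5 = \sum_(i < n) ((r%:R - 2 / 5) * a ^+ 2).
    by rewrite sumr_const card_ord -[_ *+ n]mulr_natl mulrCA sqr_inv_sqrt // mulr1.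
  apply: ler_sum => i _; rewrite -mulr_suml expr2 mulrA ler_wpM2r ?(ltW a0) //.
  have : \sum_l (a - `|Y i l|) = 2 * a / 5.
    rewrite (sum_two jk); first by case: (Yjk i) => -[-> ->]; lra.
    move=> l lj lk; rewrite Yil (negbTE lj) (negbTE lk) (feasible_entry n0 _ _ FZ).
    by rewrite subrr.
  rewrite sumrB sumr_const card_ord -[_ *+ r]mulr_natl; lra.
(* The squared distance is at least 4/5, so the error bound reads
   [4 / 5 <= kappa ^+ 2 * (2 / 5) ^+ 2]. *)
have [Z' FZ' ] := error_bound BY; have [BZ' _] := FZ'.
rewrite exY sqrtr_sqr ger0_norm // -(@ler_pXn2r _ 2) ?nnegrE ?fro_norm_ge0 //; last first.
  by rewrite mulr_ge0 // ltW.
by rewrite fro_distC (Bv_sqr_dist BY BZ') exprMn; have := dY Z' FZ'; lra.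
Qed.

End ErrorBoundConstant.

(** * First-order condition at the threshold *)

(* Majorises a norm x by a function of x^2, with equality at x = d: this is how
   the distances are made differentiable without losing contact at X. *)
Lemma amgm_linear (R : realType) (x d : R) : 0 < d -> x <= (x ^+ 2 + d ^+ 2) / (2 * d).
Proof. by move=> d0; rewrite ler_pdivlMr ?mulr_gt0 //; have := sqr_ge0 (x - d); nra. Qed.

Section Saturated.
Variables (R : realType) (n r : nat) (v : 'cV[R]_n) (f : 'M[R]_(n, r) -> R).
Variables (kappa L fstar : R) (X : 'M[R]_(n, r)) (i0 : 'I_n) (j0 : 'I_r).
Local Notation a := (Num.sqrt n%:R : R)^-1.
Local Notation feasible := (Bv r v `&` Lambda R n r).
Local Notation excess_norm Y := (Num.sqrt (\sum_i \sum_j excess Y i j ^+ 2)).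
Local Notation e := (excess X i0 j0).
Local Notation sg := (Num.sg (X i0 j0)).

Hypothesis n0 : (0 < n)%N.
Hypothesis df : forall Y, differentiable f Y.
Hypothesis kappa0 : 0 < kappa.
Hypothesis L0 : 0 < L.
Hypothesis error_bound : forall Y, Bv r v Y ->
  exists2 Z, feasible Z & fro_norm (Z - Y) <= kappa * excess_norm Y.
Hypothesis f_lip : forall Y Z, Bv r v Y -> Bv r v Z ->
  `|f Y - f Z| <= L * fro_norm (Y - Z).
Hypothesis fstar_le : forall Z, feasible Z -> fstar <= f Z.
Hypothesis BX : Bv r v X.
Hypothesis e0 : 0 < e.
Hypothesis Xle : forall i j, (i, j) != (i0, j0) -> `|X i j| <= a.
Hypothesis fX : f X + kappa * L * e <= fstar.

Implicit Types Y Z D : 'M[R]_(n, r).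

Lemma excess_normX : excess_norm X = e.
Proof.
rewrite pair_big /= (bigD1 (i0, j0)) //= big1 ?addr0 ?sqrtr_sqr ?ger0_norm ?ltW //.
by move=> [i j] ij; rewrite excess_eq0 ?expr0n //; exact: Xle.
Qed.

Lemma sgX_eq : sg * X i0 j0 = a + e.
Proof.
rewrite -normrEsg; have := e0; rewrite /excess lt_max ltxx /= => h.
by rewrite max_r ?(ltW h) // addrC subrK.
Qed.

Lemma sqr_sgX : sg ^+ 2 = 1.
Proof.
rewrite sqr_sg; case: eqP => // X0; have := sgX_eq; rewrite X0 mulr0.
by have := inv_sqrt_gt0 R n0; have := e0; lra.
Qed.

Lemma excess_sq_le Y : excess Y i0 j0 ^+ 2 <= (sg * Y i0 j0 - a) ^+ 2.
Proof.
have a0 := inv_sqrt_gt0 R n0.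
rewrite -[leRHS]real_normK ?num_real // ler_pXn2r ?nnegrE ?excess_ge0 //.
have : `|sg * Y i0 j0| = `|Y i0 j0|.
  have : `|sg| = 1 by apply/eqP; rewrite -sqrp_eq1 // real_normK ?num_real ?sqr_sgX.
  by rewrite normrM => ->; rewrite mul1r.
rewrite /excess => <-; rewrite ge_max normr_ge0 /=.
by have := lerB_dist (sg * Y i0 j0) a; rewrite (ger0_norm (ltW a0)).
Qed.

(** A smooth majorant, exact at [X]: away from [(i0, j0)] the excess vanishes at [X], so at [Y] it
    is at most the displacement of the entry. *)
Lemma excess_sumsq_le Y :
  \sum_i \sum_j excess Y i j ^+ 2 <=
    (sg * Y i0 j0 - a) ^+ 2 + fro_norm (Y - X) ^+ 2.
Proof.
rewrite sqr_fro_norm frodotE !pair_big /= (bigD1 (i0, j0)) //=.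
apply: lerD; first exact: excess_sq_le.
rewrite [leRHS](bigD1 (i0, j0)) //= -[leLHS]add0r; apply: lerD.
  by rewrite -expr2 sqr_ge0.
apply: ler_sum => -[i j] ij /=; rewrite -expr2 -[leRHS]real_normK ?num_real //.
rewrite ler_pXn2r ?nnegrE ?excess_ge0 // !mxE.
have := excess_lipschitz X Y i j.
by rewrite (excess_eq0 (Xle ij)) add0r.
Qed.

Lemma fstar_le_dist Y Z : Bv r v Y -> feasible Z ->
  fstar <= f Y + L * fro_norm (Z - Y).
Proof.
move=> BY FZ; have [BZ _] := FZ; have := f_lip BZ BY.
by rewrite ler_norml => /andP[_]; have := fstar_le FZ; lra.
Qed.

Lemma fstar_le_excess Y : Bv r v Y ->
  fstar <= f Y + kappa * L * excess_norm Y.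
Proof.
move=> BY; have [Z FZ ZY] := error_bound BY.
apply: (le_trans (fstar_le_dist BY FZ)); rewrite lerD2l.
by rewrite mulrAC mulrC ler_wpM2r // ltW.
Qed.

Lemma fX_eq : f X = fstar - kappa * L * e.
Proof. by have := fstar_le_excess BX; rewrite excess_normX; have := fX; lra. Qed.

Lemma feasible_dist_ge Z : feasible Z -> kappa * e <= fro_norm (Z - X).
Proof.
move=> FZ; have := fstar_le_dist BX FZ; rewrite fX_eq.
by move=> h; rewrite -(ler_pM2l L0); lra.
Qed.

(** Fermat's rule along the curves of [Bv_rotate] computes ['d f X D] twice, from the distance to
    [Z] in [H1] and from the excess in [H2]. Equating the results cancels [L]. *)
Lemma saturated_critical D Z :
  D *m (D^T *m D) = D -> X^T *m D + D^T *m X = 0 -> D^T *m v = 0 ->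
  feasible Z -> fro_norm (Z - X) = kappa * e ->
  frodot D Z = - (kappa ^+ 2 * e * sg * D i0 j0).
Proof.
move=> DDD XD Dv FZ dZ; have [BZ _] := FZ.
set V := X *m (D^T *m D); set d := kappa * e.
have d0 : 0 < d by rewrite mulr_gt0.
have B c s : c ^+ 2 + s ^+ 2 = 1 -> Bv r v (X + s *: D - (1 - c) *: V).
  exact: Bv_rotate.
have XD0 : frodot X D = 0.
  have := congr1 mxtrace XD; rewrite mxtraceD mxtrace0 -/(frodot X D).
  by rewrite -/(frodot D X) (frodotC D X); lra.
have dotY c s W : frodot (X + s *: D - (1 - c) *: V) W =
    frodot X W + s * frodot D W - (1 - c) * frodot V W.
  by rewrite !(frodotDl, frodotNl, frodotZl).
have dZ2 : 2 * r%:R - 2 * frodot X Z = d ^+ 2.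
  by rewrite -(Bv_sqr_dist BX BZ) fro_distC dZ.
have r2 : 2 * r%:R = d ^+ 2 + 2 * frodot X Z by rewrite -dZ2; ring.
(* On [Bv] the squared distance to [Z] is affine in [s] and [1 - c]; [amgm_linear] at [d] passes
   from it to the distance. *)
have H1 : 'd f X D = - (- (L / d) * frodot D Z).
  apply: (@fermat_rotate _ _ _ f X D V _ (L / d * frodot V Z) 0 0 0) => // c s cs.
  have := fstar_le_dist (B c s cs) FZ; rewrite fX_eq fro_distC.
  set Y := X + _ - _; have := amgm_linear (fro_norm (Y - Z)) d0.
  rewrite (Bv_sqr_dist (B c s cs) BZ) dotY.
  rewrite (_ : 2 * r%:R - _ + _ =
    2 * d * (d + (- s * frodot D Z + (1 - c) * frodot V Z) / d)); last first.
    by rewrite r2; field; rewrite gt_eqF.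
  rewrite mulrAC divff ?mul1r ?mulf_neq0 ?gt_eqF // -(ler_pM2l L0).
  rewrite [kappa * L * e]mulrAC -/d mul0r addr0.
  rewrite (_ : L * (d + _) =
    d * L + (- (L / d) * frodot D Z * s + L / d * frodot V Z * (1 - c))).
    by lra.
  by field; rewrite gt_eqF.
(* As [D] is orthogonal to [X], the displacement term of [excess_sumsq_le] is a multiple of [1 - c];
   only the entry [(i0, j0)] acts to first order. *)
have H2 : 'd f X D = - (kappa * L * sg * D i0 j0).
  pose k := kappa * L / (2 * e).
  apply: (@fermat_rotate _ _ _ f X D V _
    (kappa * L / e * frodot X V - kappa * L * sg * V i0 j0)
    k (sg * D i0 j0) (- sg * V i0 j0)) => // c s cs.
  have := fstar_le_excess (B c s cs); rewrite fX_eq.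
  set Y := X + _ - _; have := amgm_linear (excess_norm Y) e0.
  rewrite sqr_sqrtr ?excess_sumsq_ge0 //.
  have := excess_sumsq_le Y; rewrite (Bv_sqr_dist (B c s cs) BX) dotY.
  rewrite (frodotC D X) XD0 (Bv_frodot BX) (frodotC V X).
  have -> : sg * Y i0 j0 - a = e + (sg * D i0 j0 * s + - sg * V i0 j0 * (1 - c)).
    have := sgX_eq; rewrite /Y !mxE; lra.
  set w := _ * s + _; set N := excess_norm Y; set S := \sum_i _ => hS hN hf.
  have k0 : 0 < k by rewrite divr_gt0 ?mulr_gt0.
  have ke : kappa * L = k * (2 * e) by rewrite /k divfK // mulf_neq0 ?gt_eqF.
  have hkN : k * (2 * e) * N <= k * (S + e ^+ 2).
    by rewrite -mulrA ler_pM2l // mulrC -ler_pdivlMr ?mulr_gt0.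
  have hkS := ler_wpM2l (ltW k0) hS.
  rewrite (_ : kappa * L / e = 2 * k); last by rewrite ke; field; rewrite gt_eqF.
  rewrite /w in hkS *; move: hf hkN hkS; rewrite ke; lra.
have : L * frodot D Z = L * - (kappa * d * sg * D i0 j0).
  have := H1; rewrite H2 mulNr opprK => /(congr1 ( *%R d)) h.
  have <- : d * (L / d * frodot D Z) = L * frodot D Z by field; rewrite gt_eqF.
  by rewrite -h; ring.
by move/(mulfI (lt0r_neq0 L0)) ->; rewrite /d; ring.
Qed.

End Saturated.

(** * Second-order contradiction *)

Lemma cvec_unit (R : realType) n (q : 'rV[R]_n) : q != 0 ->
  exists2 c, 0 < c & \sum_i (c * q 0 i) ^+ 2 = 1.
Proof.
move=> q0; set N := \sum_i q 0 i ^+ 2.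
have N0 : 0 < N.
  have N0 : 0 <= N by apply: sumr_ge0 => i _; exact: sqr_ge0.
  rewrite lt_def N0 andbT; apply: contra_neq q0 => /psumr_eq0P q0.
  apply/rowP => i; rewrite mxE; apply/eqP; rewrite -sqrf_eq0; apply/eqP.
  by apply: q0 => // k _; exact: sqr_ge0.
exists (Num.sqrt N)^-1; first by rewrite invr_gt0 sqrtr_gt0.
under eq_bigr do rewrite exprMn.
by rewrite -mulr_sumr exprVn sqr_sqrtr ?ltW // mulVf // gt_eqF.
Qed.

(* Appending the normalised v to X gives a square orthogonal matrix, whose rows
   are unit vectors. *)
Lemma Bv_complete_row (R : realType) (n r : nat) (v : 'cV[R]_n) X i :
  n = (r + 1)%N -> v != 0 -> Bv r v X ->
  \sum_j X i j ^+ 2 = 1 - v i 0 ^+ 2 / \sum_k v k 0 ^+ 2.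
Proof.
move=> nr; subst n; move=> v0 [XX Xv].
have [c c0 cv] : exists2 c, 0 < c & \sum_i (c * v^T 0 i) ^+ 2 = 1.
  by apply: cvec_unit; rewrite -(trmx0 R) (inj_eq trmx_inj).
pose W := row_mx X (c *: v).
have WW : W^T *m W = 1%:M.
  rewrite tr_row_mx mul_col_row XX -scalemxAr Xv scaler0.
  have -> : (c *: v)^T *m X = 0.
    by apply: trmx_inj; rewrite trmx_mul trmxK -scalemxAr Xv scaler0 trmx0.
  rewrite (_ : _ *m (c *: v) = 1%:M) ?scalar_mx_block //.
  apply/matrixP => k l; rewrite !ord1 !mxE eqxx mulr1n -cv.
  by apply: eq_bigr => m _; rewrite !mxE expr2.
have cN : c ^+ 2 * \sum_k v k 0 ^+ 2 = 1.
  by rewrite -cv mulr_sumr; apply: eq_bigr => k _; rewrite mxE exprMn.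
have cE : c ^+ 2 = (\sum_k v k 0 ^+ 2)^-1.
  have N0 : \sum_k v k 0 ^+ 2 != 0.
    by apply/negP => /eqP N0; move: cN; rewrite N0 mulr0 => /eqP; rewrite eq_sym oner_eq0.
  by apply: (mulIf N0); rewrite cN mulVf.
have : \sum_k W i k ^+ 2 = 1.
  have := mulmx1C WW => /matrixP/(_ i i); rewrite !mxE eqxx mulr1n => <-.
  by apply: eq_bigr => k _; rewrite !mxE expr2.
rewrite big_split_ord /= big_ord1 row_mxEr mxE exprMn cE => <-.
rewrite [X in _ = _ + X - _]mulrC addrK.
by apply: eq_bigr => j _; rewrite row_mxEl.
Qed.

(** The half-angle parametrisation of the circle, with [s] the sine and [k] one minus the cosine;
    [t] is the tangent of the half angle. *)
Lemma small_angle (R : realType) (h : R) : 0 < h ->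
  exists s k : R, [/\ 0 < s, s <= h, 0 < k, k <= h & k * (2 - k) = s ^+ 2].
Proof.
move=> h0; pose t := Num.min 1 h / 2.
have t0 : 0 < t by rewrite divr_gt0 // lt_min ltr01.
have t1 : 2 * t <= 1 by rewrite mulrC divfK // ge_min lexx.
have th : 2 * t <= h by rewrite mulrC divfK // ge_min lexx orbT.
have d1 : 1 <= 1 + t ^+ 2 by rewrite lerDl sqr_ge0.
have d0 : 0 < 1 + t ^+ 2 by apply: lt_le_trans d1.
have tt : t ^+ 2 <= t by nra.
exists (2 * t / (1 + t ^+ 2)), (2 * t ^+ 2 / (1 + t ^+ 2)); split.
- by rewrite divr_gt0 // mulr_gt0.
- by rewrite ler_pdivrMr //; nra.
- by rewrite divr_gt0 // mulr_gt0 // exprn_gt0.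
- by rewrite ler_pdivrMr //; nra.
- by field; rewrite gt_eqF.
Qed.

(** The terms linear in [s] cancel and [s ^+ 2 = k * (2 - k)], so [k] factors out of the difference.
    There remains [2 * g], with [g] the gap in the last hypothesis, up to an error of at most
    [3 * K * h]. *)
Lemma second_order_tight (R : realType) (K e q x p : R) :
  0 < K -> `|q| <= 1 -> 0 <= x -> x <= 1 -> K * q ^+ 2 < p + K * e * x ->
  exists2 d, 0 < d & forall h s k, h <= d -> 0 < s -> s <= h -> 0 < k -> k <= h ->
    k * (2 - k) = s ^+ 2 ->
    K * (e + s * q - k * x) ^+ 2 <
      K * e ^+ 2 - 2 * s * (- (K * e * q)) + 2 * k * p.
Proof.
move=> K0 q1 x0 x1 gap; set g := p + K * e * x - K * q ^+ 2.
have g0 : 0 < g by rewrite subr_gt0.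
exists (g / (2 * K)); first by rewrite divr_gt0 ?mulr_gt0.
move=> h s k hd s0 sh k0 kh ks.
have Kh : 2 * K * h <= g by rewrite mulrC -ler_pdivlMr // mulr_gt0.
rewrite -subr_gt0.
rewrite (_ : _ - _ = k * (2 * g + K * (k * q ^+ 2 + 2 * s * (q * x) - k * x ^+ 2)));
  last first.
  rewrite (_ : K * (e + s * q - k * x) ^+ 2 = K * (e ^+ 2 + 2 * e * (s * q - k * x)
    + s ^+ 2 * q ^+ 2 - 2 * s * q * k * x + k ^+ 2 * x ^+ 2)); last by ring.
  by rewrite -ks /g; ring.
rewrite pmulr_rgt0 //.
have qx : - 1 <= q * x.
  rewrite lerNl -mulNr; apply: (le_trans (ler_wpM2r x0 (_ : - q <= 1))).
    by apply: le_trans q1; rewrite -normrN ler_norm.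
  by rewrite mul1r.
have xx : x ^+ 2 <= 1 by rewrite expr_le1.
have kq : 0 <= k * q ^+ 2 by rewrite mulr_ge0 ?sqr_ge0 // ltW.
have : - (3 * h) <= k * q ^+ 2 + 2 * s * (q * x) - k * x ^+ 2.
  have h1 : - s <= s * (q * x) by nra.
  have h2 : k * x ^+ 2 <= k by nra.
  lra.
move=> /(ler_wpM2l (ltW K0)); lra.
Qed.

(** The inequality is strict at [s = k = 0], and [M * h] bounds the variation of both sides
    together. *)
Lemma second_order_slack (R : realType) (K e q x p w d0 : R) :
  0 < K -> 0 <= e -> `|q| <= 1 -> `|x| <= 1 -> K * e ^+ 2 < d0 ->
  exists2 d, 0 < d & forall h s k, h <= d -> 0 < s -> s <= h -> 0 < k -> k <= h ->
    k * (2 - k) = s ^+ 2 ->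
    K * (e + s * q - k * x) ^+ 2 < d0 - 2 * s * w + 2 * k * p.
Proof.
move=> K0 e0 q1 x1 gap.
pose M := 2 * `|w| + 2 * `|p| + 4 * K * e + 4 * K + 1.
have M0 : 0 < M by rewrite ltr_wpDl // !addr_ge0 ?mulr_ge0 // ltW.
exists (Num.min 1 ((d0 - K * e ^+ 2) / (2 * M))).
  by rewrite lt_min ltr01 divr_gt0 ?subr_gt0 // mulr_gt0.
move=> h s k; rewrite le_min => /andP[h1 hd] s0 sh k0 kh _.
have h0 : 0 < h by apply: lt_le_trans sh.
have hM : 2 * (M * h) <= d0 - K * e ^+ 2.
  by rewrite mulrA mulrC -ler_pdivlMr // mulr_gt0.
have hM0 : 0 < M * h by rewrite mulr_gt0.
have y2 : `|s * q - k * x| <= 2 * h.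
  apply: (le_trans (ler_normB _ _)); rewrite !normrM (gtr0_norm s0) (gtr0_norm k0).
  have := normr_ge0 q; have := normr_ge0 x; nra.
have yy : (e + (s * q - k * x)) ^+ 2 <= e ^+ 2 + (4 * e + 4) * h.
  move: y2; rewrite ler_norml => /andP[]; move: (s * q - k * x) => y y1 y2.
  have : y ^+ 2 <= 4 * h by nra.
  have : e * y <= e * (2 * h) by rewrite ler_wpM2l.
  by lra.
have sw : s * w <= h * `|w|.
  apply: (le_trans (ler_wpM2l (ltW s0) (ler_norm w))).
  by rewrite ler_wpM2r.
have kp : - (k * p) <= h * `|p|.
  rewrite -mulrN -normrN; apply: (le_trans (ler_wpM2l (ltW k0) (ler_norm _))).
  by rewrite ler_wpM2r.
move/(ler_wpM2l (ltW K0)): yy; rewrite -addrA.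
move: hM hM0; rewrite /M; lra.
Qed.

(** * Geometry of a critical point with a single excess entry *)

Section CriticalExcess.
Variables (R : realType) (n r : nat) (v : 'cV[R]_n) (kappa : R).
Variables (X : 'M[R]_(n, r)) (i0 : 'I_n) (j0 : 'I_r).
Local Notation a := (Num.sqrt n%:R : R)^-1.
Local Notation feasible := (Bv r v `&` Lambda R n r).
Local Notation excess_norm Y := (Num.sqrt (\sum_i \sum_j excess Y i j ^+ 2)).
Local Notation e := (excess X i0 j0).
Local Notation sg := (Num.sg (X i0 j0)).

Hypothesis n0 : (0 < n)%N.
Hypothesis kappa0 : 0 < kappa.
Hypothesis error_bound : forall Y : 'M[R]_(n, r), Bv r v Y ->
  exists2 Z, feasible Z & fro_norm (Z - Y) <= kappa * excess_norm Y.
Hypothesis BX : Bv r v X.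
Hypothesis e0 : 0 < e.
Hypothesis Xle : forall i j, (i, j) != (i0, j0) -> `|X i j| <= a.
Hypothesis dist_ge : forall Z, feasible Z -> kappa * e <= fro_norm (Z - X).
Hypothesis critical : forall D Z : 'M[R]_(n, r),
  D *m (D^T *m D) = D -> X^T *m D + D^T *m X = 0 -> D^T *m v = 0 ->
  feasible Z -> fro_norm (Z - X) = kappa * e ->
  frodot D Z = - (kappa ^+ 2 * e * sg * D i0 j0).

Implicit Types Y Z D : 'M[R]_(n, r).

Let a0 : 0 < a. Proof. exact: inv_sqrt_gt0. Qed.

Lemma nearest_exists : exists2 Z, feasible Z & fro_norm (Z - X) = kappa * e.
Proof.
have [Z FZ] := error_bound BX; rewrite (excess_normX e0 Xle) => ZX; exists Z => //.
by apply/eqP; rewrite eq_le ZX dist_ge.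
Qed.

Lemma other_col i j : j != j0 -> `|X i j| = a.
Proof.
move=> jj0; apply: (unit_col_saturated n0 BX) => k; apply: Xle.
by apply: contra jj0 => /eqP[_ ->].
Qed.

Lemma normX0 : `|X i0 j0| = a + e.
Proof. by rewrite -(sgX_eq e0) -normrEsg. Qed.

Lemma col_entry_le i : `|X i j0| <= a + e * (i == i0)%:R.
Proof.
case: eqP => [->|/eqP ii0]; first by rewrite mulr1 normX0.
by rewrite mulr0 addr0; apply: Xle; apply: contra ii0 => /eqP[->].
Qed.

(** For the rotation of columns [j] and [j0], the first-order condition makes the left side equal to
    [|frodot D Z|]. The term [2 * a * e] is due to the entry [(i0, j0)], of modulus [a + e], as the
    entries of [Z - X] in column [j] have modulus at most [2 * a]. *)
Lemma other_col_bound j Z : j != j0 -> feasible Z ->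
  fro_norm (Z - X) = kappa * e ->
  kappa ^+ 2 * e * a <= \sum_i (Z i j - X i j) ^+ 2 + 2 * a * e.
Proof.
move=> jj0 FZ dZ; have [BZ _] := FZ.
have [DDD XD Dv] := col_rot_tangent jj0 BX.
have := critical DDD XD Dv FZ dZ; set D := col_rot X j j0.
(* Columns [j] and [j0] are orthogonal in both [X] and [Z], so both sums can be written with the
   differences [Z i j - X i j]. *)
have DZ : frodot D Z = \sum_i (X i j - Z i j) * Z i j0 -
                       \sum_i X i j0 * (Z i j - X i j).
  have ZZ := Bv_cols j j0 BZ; have XX := Bv_cols j0 j BX.
  have -> : \sum_i (X i j - Z i j) * Z i j0 = \sum_i X i j * Z i j0.
    under eq_bigr do rewrite mulrBl.
    by rewrite sumrB ZZ (negbTE jj0) subr0.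
  have -> : \sum_i X i j0 * (Z i j - X i j) = \sum_i X i j0 * Z i j.
    under eq_bigr do rewrite mulrBr.
    by rewrite sumrB XX eq_sym (negbTE jj0) subr0.
  rewrite frodotE -sumrB; apply: eq_bigr => i _.
  rewrite (sum_two jj0) /D ?col_rotE ?eqxx ?(negbTE jj0) 1?eq_sym ?(negbTE jj0).
    by rewrite /=; ring.
  by move=> l lj lj0; rewrite col_rotE (negbTE lj) (negbTE lj0); rewrite !mulr0 subr0 mul0r.
have Dij : D i0 j0 = X i0 j.
  by rewrite col_rotE eqxx eq_sym (negbTE jj0) /=; ring.
move=> cr.
have nsg : `|sg| = 1.
  by apply/eqP; rewrite -sqrp_eq1 // real_normK ?num_real // sqr_sgX.
have : `|frodot D Z| = kappa ^+ 2 * e * a.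
  rewrite cr Dij normrN !normrM nsg mulr1 other_col // (ger0_norm (ltW e0)).
  by rewrite (ger0_norm (ltW kappa0)) expr2.
move=> <-; rewrite DZ.
(* The entries of both columns are +-a, so |z - x| = (z - x)^2 / 2a. *)
have zx i : a * `|Z i j - X i j| = (Z i j - X i j) ^+ 2 / 2.
  have pm (x : R) : `|x| = a -> x = a \/ x = - a.
    by case: ger0P => _ <-; [left | right; rewrite opprK].
  case: (pm _ (feasible_entry n0 i j FZ)) => ->;
    case: (pm _ (other_col i jj0)) => ->; move: (a) a0 => b b0.
  - by rewrite subrr normr0; ring.
  - by rewrite ger0_norm; [field | lra].
  - by rewrite ler0_norm; [field | lra].
  - by rewrite subrr normr0; ring.
apply: (le_trans (ler_normB _ _)).
have S1 : `|\sum_i (X i j - Z i j) * Z i j0| <= \sum_i (Z i j - X i j) ^+ 2 / 2.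
  apply: (le_trans (ler_norm_sum _ _ _)); apply: ler_sum => i _.
  by rewrite normrM (feasible_entry n0 _ _ FZ) distrC mulrC zx.
have S2 : `|\sum_i X i j0 * (Z i j - X i j)| <=
    \sum_i (Z i j - X i j) ^+ 2 / 2 + 2 * a * e.
  apply: (le_trans (ler_norm_sum _ _ _)).
  apply: (@le_trans _ _ (\sum_i ((Z i j - X i j) ^+ 2 / 2 + 2 * a * e * (i == i0)%:R))).
    apply: ler_sum => i _; rewrite normrM.
    apply: (le_trans (ler_wpM2r (normr_ge0 _) (col_entry_le i))).
    rewrite mulrDl zx lerD2l mulrAC ler_wpM2r ?ler0n //.
    rewrite mulrC ler_wpM2r ?(ltW e0) //.
    apply: (le_trans (ler_normB _ _)).
    by rewrite (feasible_entry n0 _ _ FZ) other_col //; lra.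
  rewrite big_split /= lerD2l -mulr_sumr (bigD1 i0) //= eqxx big1 ?addr0 ?mulr1 //.
  by move=> i /negbTE ->.
apply: (le_trans (lerD S1 S2)); rewrite addrA lerD2r -big_split /=.
by apply: ler_sum => i _; lra.
Qed.

(** Summing [other_col_bound] over the [m = r - 1] other columns gives [kappa ^+ 2 * (a * m) <=
    kappa ^+ 2 * e + 2 * (a * m)]. If [2 * e < a * m], this forces [kappa ^+ 2 < 4], against
    [sqr_kappa_ge5]. *)
Lemma excess_large : a * (r%:R - 1) <= 2 * e.
Proof.
have [Z FZ dZ] := nearest_exists.
set m : R := \sum_(j < r | j != j0) 1.
have rm : r%:R - 1 = m.
  have : \sum_(j < r) (1 : R) = r%:R by rewrite sumr_const card_ord.
  by rewrite (bigD1 j0) //= -/m => <-; ring.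
rewrite rm leNgt; apply/negP => small.
have [j jj0] : exists j, j != j0.
  apply: contrapT => nj; move: small; rewrite /m big1 => [|j jj0]; last by case: nj; exists j.
  by rewrite mulr0; have := e0; lra.
have k5 := sqr_kappa_ge5 n0 kappa0 error_bound jj0 FZ.
have : \sum_(j < r | j != j0) (kappa ^+ 2 * e * a) <=
    \sum_(j < r | j != j0) (\sum_i (Z i j - X i j) ^+ 2 + 2 * a * e).
  by apply: ler_sum => k kj0; exact: other_col_bound.
rewrite big_split /=.
have S1 : \sum_(j < r | j != j0) \sum_i (Z i j - X i j) ^+ 2 <= kappa ^+ 2 * e ^+ 2.
  rewrite -exprMn -dZ sqr_fro_norm_cols [leRHS](bigD1 j0) //=.
  have -> : \sum_(j < r | j != j0) \sum_i (Z i j - X i j) ^+ 2 =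
      \sum_(j < r | j != j0) \sum_i (Z - X) i j ^+ 2.
    by apply: eq_bigr => k _; apply: eq_bigr => i _; rewrite !mxE.
  by rewrite lerDr; apply: sumr_ge0 => i _; exact: sqr_ge0.
have cm (c : R) : \sum_(j < r | j != j0) c = c * m.
  by rewrite /m mulr_sumr; apply: eq_bigr => k _; rewrite mulr1.
rewrite !cm => S2.
have t0 : 0 < a * m by have := e0; lra.
have : kappa ^+ 2 * (a * m) <= kappa ^+ 2 * e + 2 * (a * m).
  rewrite -(ler_pM2l e0); move: S1 S2; lra.
move: (a * m) (kappa ^+ 2) (e) small t0 k5 e0 => t K x; nra.
Qed.

Definition unsaturated : {set 'I_n} := [set i | `|X i j0| != a].

(** In a unit column the surplus [2 * a * e + e ^+ 2] of row [i0] is offset by the other unsaturated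
    rows, each giving up at most [a ^+ 2]. By [excess_large] at least [r] of them are required. *)
Lemma card_unsaturated : (r < #|unsaturated|)%N.
Proof.
have i0P : i0 \in unsaturated by rewrite inE normX0 -subr_eq0 addrC addKr gt_eqF.
have : \sum_i (X i j0 ^+ 2 - a ^+ 2) = 0.
  rewrite sumrB (Bv_col_norm j0 BX) sumr_const card_ord -[_ *+ n]mulr_natl.
  by rewrite sqr_inv_sqrt // subrr.
rewrite (bigD1 i0) //= -(real_normK (num_real (X i0 j0))) normX0 => sum0.
have cardP : \sum_(i < n) ((i \in unsaturated)%:R : R) = #|unsaturated|%:R.
  by rewrite -sum1_card natr_sum [RHS]big_mkcond /=; apply: eq_bigr => i _; case: ifP.
have : \sum_(i < n | i != i0) - (a ^+ 2 * (i \in unsaturated)%:R) <=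
    \sum_(i < n | i != i0) (X i j0 ^+ 2 - a ^+ 2).
  apply: ler_sum => i _; rewrite inE -(real_normK (num_real (X i j0))).
  by case: eqP => [->|_] /=; [rewrite mulr0 subrr oppr0 | rewrite mulr1 lerBrDl subrr sqr_ge0].
rewrite sumrN -mulr_sumr.
have -> : \sum_(i < n | i != i0) ((i \in unsaturated)%:R : R) = #|unsaturated|%:R - 1.
  by rewrite -cardP [in RHS](bigD1 i0) //= i0P /=; ring.
have := excess_large; rewrite -(@ltr_nat R) => large S.
have e2 : 0 < e ^+ 2 by rewrite exprn_gt0.
rewrite -(ltr_pM2l (exprn_gt0 2 a0)); move: large => /(ler_wpM2l (ltW a0)); lra.
Qed.

(** Orthogonality to [X] and [v] is [r + 1] linear conditions, whereas [card_unsaturated] guarantees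
    only [r + 1] free coordinates; the cases below gain the missing dimension. *)
Lemma column_direction : exists q : 'cV[R]_n,
  [/\ \sum_i q i 0 ^+ 2 = 1, X^T *m q = 0, q^T *m v = 0 &
      forall i, `|X i j0| = a -> X i j0 * q i 0 <= 0].
Proof.
suff [q q0 [qX qv qt]] : exists2 q : 'rV[R]_n, q != 0 &
    [/\ q *m X = 0, q *m v = 0 & forall i, `|X i j0| = a -> X i j0 * q 0 i <= 0].
  have [c c0 cq] := cvec_unit q0; exists (c *: q^T); split.
  - by under eq_bigr do rewrite !mxE.
  - by apply: trmx_inj; rewrite trmx_mul linearZ /= !trmxK -scalemxAl qX scaler0 trmx0.
  - by rewrite linearZ /= trmxK -scalemxAl qv scaler0.
  - by move=> i /qt; rewrite !mxE mulrCA (pmulr_rle0 _ c0).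
have kerS (S : {set 'I_n}) : (r + 1 < #|S|)%N -> exists2 q : 'rV[R]_n, q != 0 &
    [/\ q *m X = 0, q *m v = 0 & forall i, i \notin S -> q 0 i = 0].
  move=> /(supported_kernel (row_mx X v))[q q0 [qC qS]]; exists q => //.
  by move: qC; rewrite mul_mx_row -row_mx0 => /eq_row_mx[].
have satE i : `|X i j0| = a -> i \notin unsaturated by move=> Xa; rewrite inE Xa eqxx.
(* One saturated row [i1] is added to the support, and the sign of [q] is chosen to suit it. *)
have [[i1 i1P]|allP] := pselect (exists i1, i1 \notin unsaturated).
  have [|q q0 [qX qv qS]] := kerS (i1 |: unsaturated).
    by rewrite cardsU1 i1P addn1 /= add1n ltnS card_unsaturated.
  have qi i : `|X i j0| = a -> i != i1 -> q 0 i = 0.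
    by move=> /satE iP ii1; apply: qS; rewrite in_setU1 negb_or ii1.
  have [le0|gt0] := lerP (X i1 j0 * q 0 i1) 0.
    exists q => //; split=> // i Xa.
    by have [->//|/(qi i Xa)->] := eqVneq i i1; rewrite mulr0.
  exists (- q); first by rewrite oppr_eq0.
  split; rewrite ?mulNmx ?qX ?qv ?oppr0 // => i Xa; rewrite mxE.
  have [->|/(qi i Xa)->] := eqVneq i i1; last by rewrite oppr0 mulr0.
  by rewrite mulrN oppr_le0 ltW.
(* With no saturated row the sign condition is void, and a kernel vector exists if [r + 1 < n] or
   [v = 0]. *)
have PT i : i \in unsaturated by apply/negPn/negP => iP; apply: allP; exists i.
have nsat i : `|X i j0| <> a by move=> /satE; rewrite PT.
have Pn : #|unsaturated| = n by rewrite -[RHS]card_ord; apply: eq_card => i; rewrite PT.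
have rn : (r < n)%N by rewrite -Pn card_unsaturated.
have [rn1|] := ltnP (r + 1) n.
  have [|q q0 [qX qv _]] := kerS unsaturated; first by rewrite Pn.
  by exists q => //; split=> // i /nsat.
rewrite addn1 => nr; have {}nr : n = (r + 1)%N by apply/eqP; rewrite eqn_leq addn1 nr rn.
have [v0|v0] := eqVneq v 0.
  have [q q0 [qX _]] := supported_kernel X card_unsaturated.
  by exists q => //; split=> // [|i /nsat //]; rewrite v0 mulmx0.
(* Now [Bv_complete_row] gives row [i0] the same norm in [X] and in [Z]. But their entries there all
   have modulus [a], except one of modulus [a + e] in [X]. *)
have [Z FZ _] := nearest_exists; have [BZ _] := FZ.
have := Bv_complete_row i0 nr v0 BX; rewrite -(Bv_complete_row i0 nr v0 BZ).
rewrite [RHS](bigD1 j0) // [LHS](bigD1 j0) //=.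
have sqa (W : 'M[R]_(n, r)) i j : `|W i j| = a -> W i j ^+ 2 = a ^+ 2.
  by rewrite -(real_normK (num_real (W i j))) => ->.
rewrite (sqa Z) ?(feasible_entry n0 _ _ FZ) //.
rewrite -(real_normK (num_real (X i0 j0))) normX0.
rewrite (eq_bigr (fun=> a ^+ 2)) => [|j jj0]; last by rewrite sqa // other_col.
rewrite [in RHS](eq_bigr (fun=> a ^+ 2)) => [|j jj0]; last first.
  by rewrite sqa // (feasible_entry n0 _ _ FZ).
by have := e0; have := a0; nra.
Qed.

Lemma no_critical_excess : False.
Proof.
have [q [qq qX qv qt]] := column_direction.
pose D : 'M[R]_(n, r) := q *m delta_mx 0 j0.
have DE i l : D i l = q i 0 * (l == j0)%:R by rewrite /D mul_delta_col.
have DD : D^T *m D = delta_mx j0 j0.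
  rewrite trmx_mul trmx_delta mulmxA -(mulmxA _ q^T).
  have -> : q^T *m q = 1%:M.
    apply/matrixP => i j; rewrite !ord1 !mxE eqxx mulr1n -qq.
    by apply: eq_bigr => k _; rewrite mxE expr2.
  by rewrite mulmx1 mul_delta_mx.
have DDD : D *m (D^T *m D) = D by rewrite DD -mulmxA mul_delta_mx.
have XD : X^T *m D = 0 by rewrite mulmxA qX mul0mx.
have XDX : X^T *m D + D^T *m X = 0.
  by rewrite -[D^T *m X]trmxK trmx_mul trmxK XD trmx0 addr0.
have Dv : D^T *m v = 0 by rewrite trmx_mul -mulmxA qv mulmx0.
pose V := X *m (D^T *m D).
have VE i l : V i l = X i j0 * (l == j0)%:R by rewrite /V DD mul_delta_col.
have dotD W : frodot D W = \sum_i q i 0 * W i j0.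
  rewrite frodotE; apply: eq_bigr => i _; rewrite (bigD1 j0) //= DE eqxx mulr1.
  by rewrite big1 ?addr0 // => l lj; rewrite DE (negbTE lj) mulr0 mul0r.
have dotV W : frodot V W = \sum_i X i j0 * W i j0.
  rewrite frodotE; apply: eq_bigr => i _; rewrite (bigD1 j0) //= VE eqxx mulr1.
  by rewrite big1 ?addr0 // => l lj; rewrite VE (negbTE lj) mulr0 mul0r.
(* The rotation of column [j0] towards [q], with [k] standing for one minus the cosine. *)
pose Y s k := X + s *: D - k *: V.
have BY s k : k * (2 - k) = s ^+ 2 -> Bv r v (Y s k).
  move=> ks; have := @Bv_rotate _ _ _ v X D (1 - k) s BX DDD XDX Dv.
  by rewrite subKr; apply; rewrite -ks; ring.
have YE s k i l : Y s k i l = X i l + (s * q i 0 - k * X i j0) * (l == j0)%:R.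
  rewrite /Y; have := VE i l; have := DE i l; move: (D) (V) => D' V' hD hV.
  by rewrite !mxE hD hV; ring.
have sgX1 : `|sg| = 1.
  by apply/eqP; rewrite -sqrp_eq1 // real_normK ?num_real // sqr_sgX.
have q1 i : `|q i 0| <= 1.
  rewrite -(@ler_pXn2r _ 2) ?nnegrE // expr1n real_normK ?num_real //.
  rewrite -qq (bigD1 i) //= lerDl; apply: sumr_ge0 => k _; exact: sqr_ge0.
set q' := sg * q i0 0; set x' := a + e.
have q'1 : `|q'| <= 1 by rewrite normrM sgX1 mul1r.
have x'1 : x' <= 1 by rewrite /x' -normX0; exact: Bv_entry_le1 BX.
have x'0 : 0 <= x' by rewrite addr_ge0 // ltW.
have K0 : 0 < kappa ^+ 2 by rewrite exprn_gt0.
have sgY s k : sg * Y s k i0 j0 - a = e + s * q' - k * x'.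
  rewrite YE eqxx mulr1 mulrDr (sgX_eq e0) mulrBr mulrCA [sg * (k * _)]mulrCA.
  by rewrite (sgX_eq e0) -/q' -/x' /x'; ring.
have distY s k Z : k * (2 - k) = s ^+ 2 -> feasible Z ->
    fro_norm (Z - Y s k) ^+ 2 =
    fro_norm (Z - X) ^+ 2 - 2 * s * frodot D Z + 2 * k * frodot V Z.
  move=> ks [BZ _]; rewrite !(fro_distC Z) !(Bv_sqr_dist _ BZ) //; last exact: BY.
  by rewrite /Y !(frodotDl, frodotNl, frodotZl); ring.
have second_order Z : feasible Z -> exists2 d, 0 < d &
    forall h s k, h <= d -> 0 < s -> s <= h -> 0 < k -> k <= h ->
      k * (2 - k) = s ^+ 2 ->
      kappa ^+ 2 * (e + s * q' - k * x') ^+ 2 < fro_norm (Z - Y s k) ^+ 2.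
  move=> FZ; have [BZ _] := FZ.
  (* Nearest points need the second-order comparison; for the others the strict inequality at [X]
     persists. *)
  have := dist_ge FZ; rewrite le_eqVlt => /orP[/eqP dZ|dZ].
    have w := critical DDD XDX Dv FZ (esym dZ).
    rewrite DE eqxx mulr1 -mulrA -/q' in w.
    have [|d d0 dP] := @second_order_tight R (kappa ^+ 2) e q' x' (frodot V Z)
        K0 q'1 x'0 x'1; last first.
      exists d => // h s k *; rewrite distY // -dZ exprMn w.
      exact: (dP h).
    (* The gap condition: [frodot V Z = 1 - del / 2] with [del <= kappa ^+ 2 * e ^+ 2], and
       [x' >= e], so its right side exceeds 1. Its left side is at most 1 by [wdel] and the
       first-order condition. *)
    set del := \sum_i (Z i j0 - X i j0) ^+ 2.
    have del_le : del <= kappa ^+ 2 * e ^+ 2.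
      rewrite -exprMn dZ sqr_fro_norm_cols (bigD1 j0) //=.
      rewrite /del (eq_bigr (fun i => (Z - X) i j0 ^+ 2)) => [|i _]; last by rewrite !mxE.
      by rewrite lerDl; apply: sumr_ge0 => l _; apply: sumr_ge0 => i _; exact: sqr_ge0.
    have xZ : frodot V Z = 1 - del / 2.
      rewrite dotV /del.
      have -> : \sum_i (Z i j0 - X i j0) ^+ 2 =
          \sum_i Z i j0 ^+ 2 + \sum_i X i j0 ^+ 2 - 2 * \sum_i X i j0 * Z i j0.
        by rewrite mulr_sumr -big_split -sumrB /=; apply: eq_bigr => i _; ring.
      by rewrite (Bv_col_norm _ BX) (Bv_col_norm _ BZ); field.
    (* Cauchy-Schwarz, as q is a unit vector orthogonal to column j0 of X *)
    have wdel : frodot D Z ^+ 2 <= del.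
      have qx : \sum_i q i 0 * X i j0 = 0.
        have /matrixP/(_ j0 0) := qX; rewrite !mxE => {2}<-.
        by apply: eq_bigr => i _; rewrite mxE mulrC.
      have wE : frodot D Z = \sum_i q i 0 * (Z i j0 - X i j0).
        under eq_bigr do rewrite mulrBr.
        by rewrite sumrB qx subr0.
      have : 0 <= \sum_i (frodot D Z * q i 0 - (Z i j0 - X i j0)) ^+ 2.
        by apply: sumr_ge0 => i _; exact: sqr_ge0.
      have -> : \sum_i (frodot D Z * q i 0 - (Z i j0 - X i j0)) ^+ 2 =
          frodot D Z ^+ 2 * \sum_i q i 0 ^+ 2 + del
          - 2 * frodot D Z * \sum_i q i 0 * (Z i j0 - X i j0).
        rewrite /del; move: (frodot D Z) => t.
        rewrite !mulr_sumr -big_split -sumrB /=; apply: eq_bigr => i _; ring.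
      by rewrite qq -wE; lra.
    have Ke : 0 < kappa ^+ 2 * e ^+ 2 by rewrite mulr_gt0 // exprn_gt0.
    have Kq1 : kappa ^+ 2 * q' ^+ 2 <= 1.
      rewrite -(ler_pM2l Ke) mulr1; apply: le_trans del_le.
      by apply: le_trans wdel; rewrite w; lra.
    have : kappa ^+ 2 * e ^+ 2 <= kappa ^+ 2 * e * x'.
      by rewrite expr2 mulrA ler_pM2l ?mulr_gt0 // /x' lerDr ltW.
    by rewrite xZ; lra.
  have x'n : `|x'| <= 1 by rewrite ger0_norm.
  have gap : kappa ^+ 2 * e ^+ 2 < fro_norm (Z - X) ^+ 2.
    rewrite -exprMn ltr_pXn2r ?nnegrE ?fro_norm_ge0 //.
    by rewrite mulr_ge0 // ltW.
  have [d d0 dP] := second_order_slack (frodot V Z) (frodot D Z) K0 (ltW e0) q'1 x'n gap.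
  exists d => // h s k *; rewrite distY //; exact: (dP h).
have [h1 h10 h1P] : exists2 h1, 0 < h1 & forall Z, feasible Z ->
    forall s k, 0 < s -> s <= h1 -> 0 < k -> k <= h1 -> k * (2 - k) = s ^+ 2 ->
      kappa ^+ 2 * (e + s * q' - k * x') ^+ 2 < fro_norm (Z - Y s k) ^+ 2.
  apply: (feasible_uniform_pos n0) => Z FZ; have [d d0 dP] := second_order Z FZ.
  by exists d => // h h0 hd s k *; exact: (dP h).
have [h2 h20 h2P] : exists2 h2, 0 < h2 & forall i, `|X i j0| < a -> h2 <= a - `|X i j0|.
  apply: (@finite_uniform_pos R 'I_n (fun i h => `|X i j0| < a -> h <= a - `|X i j0|)).
  move=> i; have [Xa|Xa] := ltP `|X i j0| a; last by exists 1.
  by exists (a - `|X i j0|); rewrite ?subr_gt0.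
(* [h1] serves the second-order inequality, [h2] the entries below [a], [a] the saturated entries,
   and 1 keeps [1 - k] nonnegative. *)
have hm : 0 < Num.min (Num.min h1 h2) (Num.min a 1) by rewrite !lt_min h10 h20 a0 ltr01.
have [s [k [s0 sh k0 kh ks]]] := small_angle hm.
move: sh kh; rewrite !le_min.
move=> /andP[/andP[s1 s2] /andP[sa _]] /andP[/andP[k1 _] /andP[_ k11]].
have exY : \sum_i \sum_j excess (Y s k) i j ^+ 2 <= (e + s * q' - k * x') ^+ 2.
  rewrite pair_big /= (bigD1 (i0, j0)) //= big1 ?addr0.
    by rewrite -sgY; exact: excess_sq_le.
  move=> [i j] ij /=; rewrite excess_eq0 ?expr0n // YE.
  have [jj0|jj0] := eqVneq j j0; last by rewrite mulr0 addr0; exact: Xle.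
  subst j; have ii0 : i != i0 by apply: contra ij => /eqP ->.
  have Xa := Xle ij; have Q := q1 i.
  rewrite mulr1 (_ : _ + _ = (1 - k) * X i j0 + s * q i 0); last by ring.
  (* A saturated entry moves inward by the sign condition on [q], and [s <= a] prevents it from
     crossing the opposite bound. *)
  move: Xa; rewrite le_eqVlt => /orP[/eqP Xa|Xa].
    have sq : s * `|q i 0| <= a.
      by apply: le_trans sa; rewrite -[leRHS]mulr1 ler_wpM2l // ltW.
    have k1' : 0 <= 1 - k by rewrite subr_ge0.
    rewrite -(gtr0_norm s0) -normrM in sq.
    have := qt i Xa; move: Xa sq; rewrite !ler_norml.
    case: (lerP 0 (X i j0)) => X0.
      rewrite (ger0_norm X0) => Xa /andP[q2 q3] qX0; rewrite Xa in X0 qX0 *.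
      have qi0 : q i 0 <= 0 by rewrite -(pmulr_rle0 _ a0).
      have sq0 : s * q i 0 <= 0 by rewrite pmulr_rle0.
      by have := mulr_ge0 k1' (ltW a0); have := mulr_gt0 k0 a0;
        move=> *; apply/andP; split; lra.
    rewrite (ltr0_norm X0) => Xa /andP[q2 q3].
    have -> : X i j0 = - a by rewrite -Xa opprK.
    rewrite mulNr oppr_le0 pmulr_rge0 // => qi0.
    have sq0 : 0 <= s * q i 0 by rewrite pmulr_rge0.
    by have := mulr_ge0 k1' (ltW a0); have := mulr_gt0 k0 a0;
        move=> *; apply/andP; split; lra.
  apply: (le_trans (ler_normD _ _)); rewrite !normrM (gtr0_norm s0).
  rewrite ger0_norm ?subr_ge0 //.
  have := h2P i Xa; have := normr_ge0 (X i j0); nra.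
have [Z FZ] := error_bound (BY s k ks).
apply/negP; rewrite -ltNge -(@ltr_pXn2r _ 2) ?nnegrE ?fro_norm_ge0 //; last first.
  by rewrite mulr_ge0 ?sqrtr_ge0 // ltW.
apply: le_lt_trans (h1P Z FZ s k s0 s1 k0 k1 ks).
rewrite exprMn sqr_sqrtr ?excess_sumsq_ge0 //.
by rewrite ler_pM2l.
Qed.
End CriticalExcess.

(** * The penalty inequality and the equality of solution sets *)

Theorem theorem1 (R : realType) (n r : nat) (v : 'cV[R]_n)
  (f : 'M[R]_(n, r) -> R) (kappa : R) :
  (0 < n)%N -> (0 < r)%N ->
  binary_feasible r v !=set0 ->
  cont_differentiable f ->
  0 < kappa ->
  (forall Z, Bv r v Z ->
     fro_dist Z (Bv r v `&` Lambda R n r)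
       <= kappa * fro_dist Z (Lambda R n r)) ->
  let Lf := lip_modulus f (Bv r v) in
  let fstar := optimal_value f (Bv r v `&` Lambda R n r) in
  (forall X, Bv r v X -> 0 <= f X - fstar + kappa * Lf * hpen X) /\
  (exists2 rhobar : R, rhobar = kappa * Lf &
     forall rho : R, rhobar <= rho -> 0 < rho ->
       argmin (fun X => f X + rho * hpen X) (Bv r v)
       = argmin f (Bv r v `&` Lambda R n r)).
Proof.
move=> n0 _ [B Bbin] cdf kappa0 hoffman Lf fstar.
have F0 : Bv r v `&` Lambda R n r !=set0.
  by exists ((Num.sqrt n%:R)^-1 *: B); exact: binary_feasible_scale.
have L0 : 0 <= Lf by exact: lip_modulus_ge0.
have error_bound Y : Bv r v Y -> exists2 Z, (Bv r v `&` Lambda R n r) Z &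
    fro_norm (Z - Y) <= kappa * Num.sqrt (\sum_i \sum_j excess Y i j ^+ 2).
  move=> BY; have [Z FZ ZY] := feasible_nearest n0 Y F0; exists Z => //.
  rewrite ZY; apply: (le_trans (hoffman Y BY)).
  by rewrite ler_pM2l //; exact: fro_dist_Lambda_le.
have bound X : Bv r v X -> 0 <= f X - fstar + kappa * Lf * hpen X.
  move=> BX; have [Z FZ ZX] := error_bound X BX; have [BZ _] := FZ.
  have := optimal_value_le n0 f FZ; rewrite -/fstar.
  have := lip_modulusP cdf BZ BX; rewrite ler_norml => /andP[_].
  have := ler_wpM2l L0 ZX.
  have := ler_wpM2l (mulr_ge0 (ltW kappa0) L0) (sqrt_excess_le X).
  by rewrite hpenE -/Lf /excess; lra.
split=> //; exists (kappa * Lf) => // rho rho_ge rho0.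
have [Zs FZs fZs] := optimal_value_attained n0 f F0; have [BZs _] := FZs.
rewrite -/fstar in fZs.
have hpen_ge0 (W : 'M[R]_(n, r)) : 0 <= hpen W by rewrite hpenE; exact: excess_sum_ge0.
have hpen_feasible X : Lambda R n r X -> hpen X = 0.
  move=> LX; rewrite hpenE big1 // => i _; rewrite big1 // => j _.
  exact: excess_eq0.
have hpen_eq0 X : hpen X = 0 -> Lambda R n r X.
  rewrite hpenE => h i j; have := excess_le_sum X i j.
  by rewrite h ge_max subr_le0 => /andP[].
apply/seteqP; split=> X [SX Xmin]; last first.
  have [BX LX] := SX; split=> // Y BY.
  have fX : f X = fstar.
    by apply/eqP; rewrite eq_le optimal_value_le // andbT -fZs; exact: Xmin.
  rewrite (hpen_feasible X LX) mulr0 addr0 fX.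
  have := bound Y BY; have := ler_wpM2r (hpen_ge0 Y) rho_ge; lra.
have fX : f X + rho * hpen X <= fstar.
  have := Xmin Zs BZs; have [_ LZs] := FZs.
  by rewrite (hpen_feasible _ LZs) mulr0 addr0 fZs.
have [h0|h0] := eqVneq (hpen X) 0.
  split; first by split=> //; exact: hpen_eq0.
  move=> Y FY; apply: le_trans (optimal_value_le n0 f FY).
  by move: fX; rewrite h0 mulr0 addr0.
exfalso; have h_gt0 : 0 < hpen X by rewrite lt_def h0 hpen_ge0.
(* Minimality bounds [rho * hpen X] by [fstar - f X], which [bound] caps by
   [kappa * Lf * hpen X]. *)
have rhoE : rho = kappa * Lf.
  apply/eqP; rewrite eq_le rho_ge andbT -(ler_pM2r h_gt0).
  by have := bound X SX; lra.
have Lf0 : 0 < Lf by move: rho0; rewrite rhoE pmulr_rgt0.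
have f_lip Y Z : Bv r v Y -> Bv r v Z -> `|f Y - f Z| <= Lf * fro_norm (Y - Z).
  exact: lip_modulusP.
have fstar_le Z : (Bv r v `&` Lambda R n r) Z -> fstar <= f Z by exact: optimal_value_le.
have [df _] := cdf.
have hE : hpen X = \sum_i \sum_j excess X i j by rewrite hpenE.
(* At the threshold the l1 norm of the excesses is at most their l2 norm, so a single entry carries
   all the excess. *)
have [||i0 [j0 [e0 eE Xle]]] := @excess_single R n r X; first by rewrite -hE.
  have := fstar_le_excess Lf0 error_bound f_lip fstar_le SX.
  move: fX; rewrite rhoE -hE => hX hS.
  by rewrite -(ler_pM2l (_ : 0 < kappa * Lf)) ?mulr_gt0 //; lra.
have fXe : f X + kappa * Lf * excess X i0 j0 <= fstar by rewrite eE -hE -rhoE.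
apply: (no_critical_excess n0 kappa0 error_bound SX e0 Xle).
- exact: feasible_dist_ge Lf0 error_bound f_lip fstar_le SX e0 Xle fXe.
- exact: saturated_critical n0 df kappa0 Lf0 error_bound f_lip fstar_le SX e0 Xle fXe.
Qed.
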